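(* Let $c>0$, $T>0$, and let $u$ be the exact solution of the obstacle problem $\min(u_t+cu_x,\,u-g(x))=0$, $u(0,x)=u_0(x)$ on $(0,1)$ with periodic boundary conditions. Let $\ell\ge2$ and $k\ge1$ and assume that $u$ is not shattering on $[0,T]$ with this $\ell$, i.e. there are constants $p,L,c_0$ such that $u(t,\cdot)\in\mathcal C^{\ell+1}_{p,L,c_0}(0,1)$ for all $t\in[0,T]$. Assume the CFL condition $\Delta t\le C_0h$ with $C_0$ small enough (the usual CFL condition for stability of the RKDG scheme). Let $\tilde g$ be either $g_{\Delta t}$ or $x\mapsto\max(g(x),g(x-c\Delta t))$. Let $u_h^0=\Pi_hu_0$ and, for $n\ge0$, let $u_h^{n+1}$ be the unique element of $V_h$ such that $$u_h^{n+1}(x^j_\alpha)=\max\big(G^{RK}_{\Delta t}(u_h^n)(x^j_\alpha),\ \tilde g(x^j_\alpha)\big),\qquad j=1,\dots,N,\ \alpha=0,\dots,k .$$ Write $u^n=u(n\Delta t,\cdot)$. Then for both choices of $\tilde g$ there is a constant $C\ge0$ independent of $h,\Delta t,u_h$ such that for all $n\ge 0$ with $n\Delta t\le T$ $$\|u_h^n-u^n\|\le C\Big(h+\frac{h^3}{\Delta t^2}\Big)^{1/2}.$$ In particular, if $\Delta t/h$ is bounded from below ($\Delta t/h\ge\bar C_0$ for some constant $\bar C_0>0$), then $\|u_h^n-u^n\|\le C_1h^{1/2}$ for some constant $C_1$.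
   Context: Periodicity: all functions on $(0,1)$ are identified with their $1$-periodic extensions, and the function classes below are understood for periodic functions. The data $u_0,g$ are Lipschitz continuous. Exact solution: the (viscosity) solution is $u(0,\cdot)=u_0$ and, for $t>0$, $u(t,x)=\max\big(u_0(x-ct),\,g_t(x)\big)$, where $g_t(x):=\max_{\theta\in[0,t]}g(x-c\theta)$. Mesh and space: $I_j=(x_{j-1/2},x_{j+1/2})$, $j=1,\dots,N$, is a partition of $I=(0,1)$, $h_j=|I_j|$, $h=\max_j h_j$, $V_h$ is the space of functions whose restriction to each $I_j$ is a polynomial of degree at most $k$. The meshes are such that the inverse inequalities $\|(\varphi_h)_x\|\le Ch^{-1}\|\varphi_h\|$ (elementwise derivative) and $\|\varphi_h\|_{L^\infty}\le Ch^{-1/2}\|\varphi_h\|$ hold for all $\varphi_h\in V_h$ with $C$ independent of $h$ (quasi-uniform meshes). $\Pi_h$ is the $L^2$ projection onto $V_h$; $(\cdot,\cdot)$ and $\|\cdot\|$ are the $L^2(0,1)$ inner product and norm. $\Delta t>0$ is the time step. $(x^j_\alpha)_{\alpha=0,\dots,k}$ are the $k+1$ Gauss-Legendre quadrature points on $I_j$. Runge-Kutta DG (RKDG) operator: superscripts $\mp$ denote left/right limits at the cell interfaces (with periodic identification of the endpoints). Let $\mathcal H(\phi,\varphi)=\sum_j\mathcal H_j(\phi,\varphi)$ with $$\mathcal H_j(\phi,\varphi)=\int_{I_j}c\,\phi\,\varphi_x\,dx-c\big(\phi^-_{j+1/2}\varphi^-_{j+1/2}-\phi^-_{j-1/2}\varphi^+_{j-1/2}\big).$$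 For $v_h\in V_h$, $G^{RK}_{\Delta t}(v_h):=w_h\in V_h$ is obtained from $v_h^1,v_h^2\in V_h$ by the TVD-RK3 steps, for all $\varphi_h\in V_h$: $(v_h^1-v_h,\varphi_h)=\Delta t\,\mathcal H(v_h,\varphi_h)$; $\ (v_h^2-\tfrac34v_h-\tfrac14v_h^1,\varphi_h)=\tfrac{\Delta t}{4}\mathcal H(v_h^1,\varphi_h)$; $\ (w_h-\tfrac13v_h-\tfrac23v_h^2,\varphi_h)=\tfrac{2\Delta t}{3}\mathcal H(v_h^2,\varphi_h)$. Function class: $\mathcal C^{\ell+1}_{p,L,c_0}(0,1)$ is the set of $v:(0,1)\to\mathbb R$ that are Lipschitz continuous with $\|v'\|_{L^\infty}\le L$, piecewise $C^{\ell+1}$ with $\|v^{(\ell+1)}\|_{L^\infty}\le c_0$ (the derivative being taken almost everywhere), and have at most $p\ge 0$ non-regular points (points near which $v$ is not $C^{\ell+1}$). *)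

(* Defs.v *)
(* MathComp-Analysis, over an arbitrary R : realType. *)
From HB Require Import structures.
From mathcomp Require Import all_boot all_order all_algebra.
From mathcomp Require Import all_classical all_reals all_analysis.

Set Implicit Arguments.
Unset Strict Implicit.
Unset Printing Implicit Defensive.

Import Order.TTheory GRing.Theory Num.Theory.
Import numFieldNormedType.Exports.

Local Open Scope classical_set_scope.
Local Open Scope ring_scope.

Section L2.
Variable R : realType.
Implicit Types (f g : R -> R) (M : R).

Definition L2_dot f g : R :=
  \int[@lebesgue_measure R]_(x in `]0, 1[%classic) (f x * g x).

Definition L2_norm f : R := Num.sqrt (L2_dot f f).

(* ||f||_{L^oo(0,1)} <= M *)
Definition Linfty_le f M : Prop :=
  {ae @lebesgue_measure R, forall x : R, x \in `]0, 1[ -> `|f x| <= M}.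

End L2.

(* Functions on (0,1) are represented by their 1-periodic extensions R -> R. *)
Section ExactSolution.
Variable R : realType.
Implicit Types (c t x : R) (g : R -> R).

(* g_t; the supremum is a maximum when g is continuous and 0 <= t. *)
Definition obstacle_max c g t x : R :=
  sup [set g (x - c * theta) | theta in `[0, t]].

(* The explicit viscosity solution. No compatibility u0 >= g is required,
   which is why t = 0 is treated apart. *)
Definition exact_solution c (u0 : R -> R) g t x : R :=
  if t == 0 then u0 x else Num.max (u0 (x - c * t)) (obstacle_max c g t x).

Variant obstacle_rule := WindowMax | EndpointMax.

Definition gtilde (rule : obstacle_rule) c g dt x : R :=
  match rule with
  | WindowMax => obstacle_max c g dt x
  | EndpointMax => Num.max (g x) (g (x - c * dt))
  end.

End ExactSolution.

Section FunctionClass.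
Variable R : realType.
Implicit Types (v : R -> R) (x L : R).

Definition Cm_near (m : nat) v x : Prop :=
  \forall y \near x,
    (forall i, (i < m)%N -> derivable (derive1n i v) y 1) /\
    {for y, continuous (derive1n m v)}.

(* One period suffices: 0 and 1 are the same point of the circle. *)
Definition nonregular_points (m : nat) v : set R :=
  [set x : R | (x \in `[0, 1[) /\ ~ Cm_near m v x].

(* C^{l+1}_{p,L,c0}. Outside the finitely many nonregular points v is
   C^{l+1}, which is the required piecewise regularity; derivatives are
   constrained almost everywhere only. *)
Definition piecewise_class (l p : nat) L (c0 : R) v : Prop :=
  [/\ lipschitz v,
      Linfty_le (derive1n 1 v) L,
      (nonregular_points l.+1 v #<= `I_p)%card
    & Linfty_le (derive1n l.+1 v) c0].

Definition not_shattering (l : nat) (T : R) (u : R -> R -> R) : Prop :=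
  exists (p : nat) (L c0 : R),
    forall t, 0 <= t <= T -> piecewise_class l p L c0 (u t).

End FunctionClass.

(* Cells are numbered from 0: cell j is ]node j, node j.+1[, so that
   node j stands for x_{j+1/2}. The values of node beyond ncells are
   irrelevant. *)
Record mesh (R : realType) := Mesh {
  ncells : nat;
  node : nat -> R;
  node_first : node 0 = 0;
  node_last : node ncells = 1;
  node_lt : forall j, (j < ncells)%N -> node j < node j.+1 }.

Section DG.
Variables (R : realType) (m : mesh R).

Definition cell (j : 'I_(ncells m)) : interval R := `]node m j, node m j.+1[.

Definition cell_size (j : 'I_(ncells m)) : R := node m j.+1 - node m j.

Definition mesh_size : R := \big[Num.max/0]_(j < ncells m) cell_size j.

(* A piecewise polynomial, given by its restriction to each cell. Its traces
   at the interfaces are the values there of the polynomials of the two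
   adjacent cells. *)
Definition broken_poly : Type := {ffun 'I_(ncells m) -> {poly R}}.

Implicit Types (v w phi : broken_poly) (f : R -> R).

Definition in_Vh (k : nat) v : Prop := forall j, (size (v j) <= k.+1)%N.

(* The function on the union of the cells; 0 at the interfaces. *)
Definition dg_fun v (x : R) : R :=
  \sum_(j < ncells m) if x \in cell j then (v j).[x] else 0.

Definition dg_deriv v : broken_poly := [ffun j => (v j)^`()].

Definition inverse_inequalities (k : nat) (Cinv : R) : Prop :=
  forall phi, in_Vh k phi ->
    L2_norm (dg_fun (dg_deriv phi)) <= Cinv / mesh_size * L2_norm (dg_fun phi)
    /\ Linfty_le (dg_fun phi)
         (Cinv / Num.sqrt mesh_size * L2_norm (dg_fun phi)).

(* phi^-_{j+1/2}, and phi^-_{j-1/2}, phi^+_{j-1/2} at the left end of cell j;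
   ord_pred is cyclic, so phi^- at the left end of cell 0 is phi^- at x = 1. *)
Definition trace_right v j : R := (v j).[node m j.+1].
Definition trace_left_minus v j : R := trace_right v (ord_pred j).
Definition trace_left_plus v j : R := (v j).[node m j].

Definition dgH_cell (c : R) v phi (j : 'I_(ncells m)) : R :=
  \int[@lebesgue_measure R]_(x in [set` cell j])
     (c * (v j).[x] * (phi j)^`().[x])
  - c * (trace_right v j * trace_right phi j
         - trace_left_minus v j * trace_left_plus phi j).

Definition dgH (c : R) v phi : R := \sum_(j < ncells m) dgH_cell c v phi j.

(* w = G^{RK}_{dt}(v) *)
Definition rk_step (k : nat) (c dt : R) v w : Prop :=
  exists v1 v2, [/\ in_Vh k v1, in_Vh k v2, in_Vh k w &
    forall phi, in_Vh k phi ->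
    [/\ L2_dot (fun x => dg_fun v1 x - dg_fun v x) (dg_fun phi)
          = dt * dgH c v phi,
        L2_dot (fun x => dg_fun v2 x - 3 / 4 * dg_fun v x
                         - 1 / 4 * dg_fun v1 x) (dg_fun phi)
          = dt / 4 * dgH c v1 phi
      & L2_dot (fun x => dg_fun w x - 1 / 3 * dg_fun v x
                         - 2 / 3 * dg_fun v2 x) (dg_fun phi)
          = 2 * dt / 3 * dgH c v2 phi]].

(* v = Pi_h f *)
Definition L2_projection (k : nat) f v : Prop :=
  in_Vh k v /\ forall phi, in_Vh k phi ->
    L2_dot (dg_fun v) (dg_fun phi) = L2_dot f (dg_fun phi).

End DG.

Section GaussLegendre.
Variable R : realType.

(* Rodrigues' formula *)
Definition legendre (n : nat) : {poly R} :=
  (2 ^+ n * n`!%:R)^-1 *: derivn n (('X ^+ 2 - 1) ^+ n).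

(* xi lists the k+1 Gauss-Legendre points of the reference cell (-1,1). *)
Definition gauss_legendre (k : nat) (xi : 'I_k.+1 -> R) : Prop :=
  injective xi /\ forall a, root (legendre k.+1) (xi a).

(* x^j_a *)
Definition gauss_point (k : nat) (xi : 'I_k.+1 -> R) (m : mesh R)
    (j : 'I_(ncells m)) (a : 'I_k.+1) : R :=
  (node m j + node m j.+1) / 2 + cell_size j / 2 * xi a.

Definition rkdg_obstacle_scheme (k : nat) (xi : 'I_k.+1 -> R) (c dt : R)
    (u0 gt : R -> R) (m : mesh R) (uh : nat -> broken_poly m) : Prop :=
  L2_projection k u0 (uh 0%N) /\
  forall n, in_Vh k (uh n.+1) /\
    exists2 w, rk_step k c dt (uh n) w &
      forall j a, let x := gauss_point xi j a in
        (uh n.+1 j).[x] = Num.max (w j).[x] (gt x).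

End GaussLegendre.

(* Main.v *)
(* At the Gauss points the projection step is a pointwise maximum, which is
   nonexpansive, and by exactness of the quadrature the L^2 norm on V_h is a
   weighted l^2 norm of the values there. Since the RK3 step is a contraction
   under the CFL condition, the distance from u_h^n to the Gauss interpolant of
   u^n grows per step by at most the truncation error plus the error of the
   rule defining the obstacle.

   A nonshattering solution has a space derivative of total variation bounded
   uniformly in time: a bound on its (l+1)-st derivative makes u_x piecewise
   monotone or Lipschitz with boundedly many pieces between nonregular points.
   So on a patch of O(1) cells around cell j, u is within h tau_j of a linear
   function, where the sum of the tau_j^2 is bounded. The scheme transports
   linear functions exactly, so the truncation error is O(h^{3/2}); the obstacle
   error is 0, or at most 3 c dt tau_j pointwise, i.e. O(dt h^{1/2}) in L^2.
   Summing over at most T / dt steps gives h^{3/2} / dt + h^{1/2}. *)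
Require Import Defs.
From HB Require Import structures.
From mathcomp Require Import all_boot all_order all_algebra.
From mathcomp Require Import all_classical all_reals all_analysis.
From mathcomp Require Import ring lra.

Set Implicit Arguments.
Unset Strict Implicit.
Unset Printing Implicit Defensive.

Import Order.TTheory GRing.Theory Num.Theory.
Import numFieldNormedType.Exports.

Local Open Scope classical_set_scope.
Local Open Scope ring_scope.

(** * Integrals of polynomials and Gauss-Legendre quadrature *)

(** Since [u_x] may jump at free-boundary points and at kinks of [g], [tau_j] is of order 1 on some
    patches, where the local error is only [O(h)]. The extra half power comes solely from the bound
    on the sum of the [tau_j ^+ 2]. The variation of [u_x] is therefore carried by a monotone
    function: it yields a linear model on each patch, and its increments are what is summed. The
    first time step is separate. No compatibility of [u0] with [g] is assumed, so [u] may be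
    discontinuous at [t = 0], while the comparison of the endpoint rule with the window maximum
    needs [u t >= g]. A single step may be charged [K * c * dt], which is [O(h)]; charging every
    step so would give [O(1)]. The CFL constant is chosen so that [dt] times the spatial operator is
    itself a contraction of [V_h]. This closes the energy estimate for RK3 and makes the cubic
    Runge-Kutta term no larger than the quadratic one. *)

Section PolyIntegral.
Variable R : realType.
Implicit Types (p q P : {poly R}) (a b c x : R).

(** A primitive, so that integrals on [V_h] become algebra; the link with the Lebesgue integral is
    [Rintegral_poly]. Its constant term is 0 because division by 0 gives 0. *)
Definition pprim p : {poly R} := \poly_(i < (size p).+1) (p`_i.-1 / i%:R).

Definition pint a b p : R := (pprim p).[b] - (pprim p).[a].

Lemma pprimK p : (pprim p)^`() = p.
Proof.
apply/polyP => i; rewrite coef_deriv coef_poly ltnS /=.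
case: ltnP => [_|hi]; last by rewrite mul0rn nth_default.
by rewrite -[LHS]mulr_natr mulfVK// pnatr_eq0.
Qed.

Lemma pintE P p a b : P^`() = p -> pint a b p = P.[b] - P.[a].
Proof.
move=> dP; pose D := P - pprim p.
have D0 : D = (D`_0)%:P.
  apply/polyP => -[|i]; rewrite coefC//=.
  have : D^`()`_i = 0 by rewrite derivB dP pprimK subrr coef0.
  by rewrite coef_deriv => /eqP; rewrite mulrn_eq0/= => /eqP.
have -> : P = pprim p + (D`_0)%:P by rewrite -D0 /D addrC subrK.
by rewrite /pint !hornerE opprD addrACA subrr addr0.
Qed.

Lemma pintD a b p q : pint a b (p + q) = pint a b p + pint a b q.
Proof.
have dP : (pprim p + pprim q)^`() = p + q by rewrite derivD !pprimK.
by rewrite (pintE _ _ dP) /pint !hornerD opprD addrACA.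
Qed.

Lemma pintZ a b c p : pint a b (c *: p) = c * pint a b p.
Proof.
have dP : (c *: pprim p)^`() = c *: p by rewrite derivZ pprimK.
by rewrite (pintE _ _ dP) /pint !hornerZ mulrBr.
Qed.

Lemma pint0 a b : pint a b 0 = 0.
Proof. by rewrite -(scale0r 0) pintZ mul0r. Qed.

Lemma pintN a b p : pint a b (- p) = - pint a b p.
Proof. by rewrite -scaleN1r pintZ mulN1r. Qed.

Lemma pintB a b p q : pint a b (p - q) = pint a b p - pint a b q.
Proof. by rewrite pintD pintN. Qed.

Lemma pint_sum a b (I : Type) (r : seq I) (P : pred I) (F : I -> {poly R}) :
  pint a b (\sum_(i <- r | P i) F i) = \sum_(i <- r | P i) pint a b (F i).
Proof. by apply: (big_morph (pint a b)); [exact: pintD|exact: pint0]. Qed.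

Lemma pintC a b c : pint a b c%:P = c * (b - a).
Proof.
have dP : (c *: 'X)^`() = c%:P :> {poly R} by rewrite derivZ derivX alg_polyC.
by rewrite (pintE _ _ dP) !hornerZ !hornerX mulrBr.
Qed.

Lemma pint_by_parts a b p q :
  pint a b (p * q^`()) = (p * q).[b] - (p * q).[a] - pint a b (p^`() * q).
Proof.
rewrite -[X in _ = X - _](@pintE (p * q) _ a b erefl) derivM pintD; lra.
Qed.

Lemma pint_mvt a b p : a < b ->
  exists2 x, a < x < b & pint a b p = p.[x] * (b - a).
Proof.
move=> ab.
have dP (x : R) : x \in `]a, b[ -> is_derive x (1 : R) (horner (pprim p)) p.[x].
  by move=> _; rewrite -{2}(pprimK p); exact: is_derive_poly.
have [|x] := MVT ab dP; first exact/continuous_subspaceT/continuous_horner.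
by rewrite in_itv/= => xab e; exists x.
Qed.

Lemma pint_ge0 a b p : a <= b -> (forall x, a < x < b -> 0 <= p.[x]) ->
  0 <= pint a b p.
Proof.
rewrite le_eqVlt => /predU1P[-> _|ab p0]; first by rewrite /pint subrr.
have [x /p0 px ->] := pint_mvt p ab.
by rewrite mulr_ge0// subr_ge0 ltW.
Qed.

Lemma pint_cat a b c p : pint a c p = pint a b p + pint b c p.
Proof. by rewrite /pint; lra. Qed.

Lemma poly_eq0_itv a b p : a < b -> (forall x, a < x < b -> p.[x] = 0) -> p = 0.
Proof.
move=> ab p0.
pose rs := [seq a + (b - a) / i.+2%:R | i <- iota 0 (size p)].
apply: (@roots_geq_poly_eq0 _ _ rs); last by rewrite size_map size_iota.
- apply/allP => x /mapP[i _ ->]; apply/rootP/p0.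
  have i0 : (0 : R) < i.+2%:R by rewrite ltr0n.
  apply/andP; split; first by rewrite ltrDl divr_gt0// subr_gt0.
  rewrite -ltrBrDl ltr_pdivrMr// ltr_pMr ?subr_gt0//.
  by rewrite ltr1n.
- rewrite map_inj_uniq ?iota_uniq// => i j /addrI/mulfI.
  by rewrite subr_eq0 gt_eqF// => /(_ isT)/invr_inj/(mulrIn (oner_neq0 _))[].
Qed.

(** The integrals over [[a, x]] and [[x, b]] are nonnegative with sum 0, so the primitive is
    constant on the interval. *)
Lemma pint_eq0 a b p : a < b -> (forall x, a < x < b -> 0 <= p.[x]) ->
  pint a b p = 0 -> p = 0.
Proof.
move=> ab p0 pab; rewrite -(pprimK p).
suff -> : pprim p = (pprim p).[a]%:P by rewrite derivC.
apply/eqP; rewrite -subr_eq0; apply/eqP/(poly_eq0_itv ab) => x /andP[ax xb].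
rewrite !hornerE -[LHS]/(pint a x p).
have h1 : 0 <= pint a x p.
  apply: pint_ge0 => [|y /andP[ay yx]]; first exact: ltW.
  by apply: p0; rewrite ay (lt_trans yx).
have h2 : 0 <= pint x b p.
  apply: pint_ge0 => [|y /andP[ay yx]]; first exact: ltW.
  by apply: p0; rewrite yx (lt_trans ax).
by move: pab; rewrite (pint_cat a x b); lra.
Qed.

Lemma pint_affine a b p : pint a b p =
  (b - a) / 2 * pint (-1) 1 (p \Po (((b - a) / 2) *: 'X + ((a + b) / 2)%:P)).
Proof.
set s := (b - a) / 2; set q := s *: 'X + _.
have dP : (pprim p \Po q)^`() = s *: (p \Po q).
  rewrite deriv_comp pprimK derivD derivC addr0 derivZ derivX alg_polyC.
  by rewrite mulrC mul_polyC.
rewrite -pintZ (pintE _ _ dP) /pint !horner_comp /q /s !hornerE.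
by congr (_ .[ _ ] - _ .[ _ ]); field.
Qed.

End PolyIntegral.

Section Quadrature.
Variables (R : realType) (k : nat) (xi : 'I_k.+1 -> R).
Hypothesis hxi : gauss_legendre xi.
Implicit Types (p q : {poly R}).

(** The factor that remains makes the boundary terms at -1 and 1 vanish in [legendre_orth]. *)
Lemma derivn_sqr_sub1 (n i : nat) : (i <= n)%N ->
  exists q : {poly R}, derivn i (('X ^+ 2 - 1) ^+ n) = ('X ^+ 2 - 1) ^+ (n - i) * q.
Proof.
elim: i => [_|i IH hi]; first by exists 1; rewrite mulr1 subn0.
have [q e] := IH (ltnW hi).
set W := 'X ^+ 2 - 1 in e *; set m := (n - i.+1)%N.
exists ((W^`() *+ m.+1) * q + W * q^`()).
rewrite derivnS e -(subnSK hi) -/m derivM deriv_exp /= exprS mulrDr; congr (_ + _).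
  by rewrite mulrA; congr (_ * _); rewrite mulrnAr mulrC.
by rewrite mulrCA -!mulrA.
Qed.

Lemma size_deriv_leq p m : (size p <= m.+1)%N -> (size p^`() <= m)%N.
Proof.
move=> sp; apply/leq_sizeP => j mj.
by rewrite coef_deriv nth_default ?mul0rn// (leq_trans sp).
Qed.

(** Each integration by parts moves one derivative from the Rodrigues power onto [q]; after [i] of
    them [q] is differentiated away. *)
Lemma legendre_orth (n i : nat) q : (i <= n)%N -> (size q <= i)%N ->
  pint (-1) 1 (q * derivn i (('X ^+ 2 - 1) ^+ n)) = 0.
Proof.
elim: i q => [|i IH] q.
  by move=> _; rewrite leqn0 size_poly_eq0 => /eqP ->; rewrite mul0r pint0.
move=> hi hq; rewrite derivnS pint_by_parts IH ?(ltnW hi)//; last first.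
  exact: size_deriv_leq.
have [r ->] := derivn_sqr_sub1 (ltnW hi).
have z (x : R) : x ^+ 2 = 1 -> (q * (('X ^+ 2 - 1) ^+ (n - i) * r)).[x] = 0.
  move=> x1; rewrite -(subnSK hi) exprS !hornerM hornerD hornerN hornerXn x1.
  by rewrite hornerC subrr !mul0r mulr0.
by rewrite !z ?sqrrN ?expr1n// !subr0.
Qed.

Lemma size_sqr_sub1 (n : nat) : size (('X ^+ 2 - 1 : {poly R}) ^+ n) = (n + n).+1.
Proof.
have -> : ('X ^+ 2 - 1 : {poly R}) = 'X^2 - 1%:P by rewrite polyC1.
have s3 : size ('X^2 - 1%:P : {poly R}) = 3%N by rewrite size_XnsubC.
have W0 : ('X^2 - 1%:P : {poly R}) ^+ n != 0.
  by rewrite expf_neq0// -size_poly_eq0 s3.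
by rewrite -[LHS]prednK ?size_poly_gt0// size_exp s3 /= mulSn mul1n.
Qed.

Lemma size_legendre (n : nat) : size (legendre R n) = n.+1.
Proof.
rewrite /legendre size_scale; last first.
  by rewrite invr_eq0 mulf_neq0 ?expf_neq0 ?pnatr_eq0 -?lt0n ?fact_gt0.
set W := _ ^+ n; apply/eqP; rewrite eqn_leq; apply/andP; split.
  apply/leq_sizeP => j hj; rewrite coef_derivn nth_default ?mul0rn//.
  by rewrite size_sqr_sub1 -addnS leq_add2l.
rewrite ltnNge; apply/negP => /leq_sizeP/(_ n (leqnn _)).
rewrite coef_derivn => /eqP; rewrite mulrn_eq0 -leqn0 leqNgt ffact_gt0 leq_addl/=.
have -> : (n + n)%N = (size W).-1 by rewrite size_sqr_sub1.
by rewrite -[_`__]/(lead_coef W) lead_coef_eq0 -size_poly_eq0 size_sqr_sub1.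
Qed.

Definition gauss_poly : {poly R} := \prod_(a < k.+1) ('X - (xi a)%:P).

Lemma size_gauss_poly : size gauss_poly = k.+2.
Proof. by rewrite size_prod_XsubC /index_enum -enumT size_enum_ord. Qed.

Lemma gauss_poly_monic : gauss_poly \is monic.
Proof. exact: monic_prod_XsubC. Qed.

Lemma gauss_poly_xi a : gauss_poly.[xi a] = 0.
Proof. by rewrite /gauss_poly (bigD1 a)//= hornerM hornerXsubC subrr mul0r. Qed.

Lemma legendreE : legendre R k.+1 = lead_coef (legendre R k.+1) *: gauss_poly.
Proof.
have [xi_inj xi_root] := hxi.
rewrite {1}(@all_roots_prod_XsubC _ (legendre R k.+1) [seq xi a | a <- enum 'I_k.+1]).
- by rewrite big_map big_enum.
- by rewrite size_map size_enum_ord size_legendre.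
- by apply/allP => _ /mapP[a _ ->].
- by rewrite uniq_rootsE map_inj_uniq ?enum_uniq.
Qed.

Lemma gauss_orth q : (size q <= k.+1)%N -> pint (-1) 1 (q * gauss_poly) = 0.
Proof.
move=> hq; set l := lead_coef (legendre R k.+1).
have l0 : l != 0 by rewrite lead_coef_eq0 -size_poly_eq0 size_legendre.
have -> : gauss_poly = l^-1 *: legendre R k.+1.
  by rewrite legendreE -/l scalerA mulVf// scale1r.
by rewrite /legendre -!scalerAr !pintZ legendre_orth// !mulr0.
Qed.

Definition nodal (a : 'I_k.+1) : {poly R} :=
  (\prod_(b < k.+1 | b != a) (xi a - xi b))^-1 *:
    \prod_(b < k.+1 | b != a) ('X - (xi b)%:P).

Lemma size_nodal a : (size (nodal a) <= k.+1)%N.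
Proof.
apply: (leq_trans (size_scale_leq _ _)).
rewrite -big_filter size_prod_XsubC ltnS size_filter -sum1_count.
by rewrite sum1_card cardC1 card_ord.
Qed.

Lemma nodal_xi a b : (nodal a).[xi b] = (a == b)%:R.
Proof.
have [xi_inj _] := hxi.
rewrite /nodal hornerZ horner_prod; have [<-|ab] := eqVneq a b.
  under eq_bigr do rewrite hornerXsubC.
  rewrite mulVf//; apply/prodf_neq0 => i ia; rewrite subr_eq0.
  by apply: contra ia => /eqP/xi_inj ->.
by rewrite [X in _ * X](bigD1 b) 1?eq_sym//= hornerXsubC subrr mul0r mulr0.
Qed.

Lemma interp_inj p q : (size p <= k.+1)%N -> (size q <= k.+1)%N ->
  (forall a, p.[xi a] = q.[xi a]) -> p = q.
Proof.
have [xi_inj _] := hxi; move=> sp sq pq; apply/eqP; rewrite -subr_eq0; apply/eqP.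
apply: (@roots_geq_poly_eq0 _ _ [seq xi a | a <- enum 'I_k.+1]).
- by apply/allP => _ /mapP[a _ ->]; rewrite rootE !hornerE pq subrr.
- by rewrite map_inj_uniq ?enum_uniq.
- rewrite size_map size_enum_ord (leq_trans (size_polyD _ _))// size_polyN.
  by rewrite geq_max sp.
Qed.

Definition interp (f : 'I_k.+1 -> R) : {poly R} := \sum_(a < k.+1) f a *: nodal a.

Lemma interp_xi f a : (interp f).[xi a] = f a.
Proof.
rewrite horner_sum (bigD1 a)//= hornerZ nodal_xi eqxx mulr1 big1 ?addr0// => b ba.
by rewrite hornerZ nodal_xi (negbTE ba) mulr0.
Qed.

Lemma size_interp f : (size (interp f) <= k.+1)%N.
Proof.
apply: (leq_trans (size_sum _ _ _)); apply/bigmax_leqP => a _.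
exact: leq_trans (size_scale_leq _ _) (size_nodal a).
Qed.

Definition gauss_weight (a : 'I_k.+1) : R := pint (-1) 1 (nodal a).

(** Division by [gauss_poly]: the quotient has degree at most [k], so its term integrates to 0; the
    remainder takes the values of [p] at the nodes and is their interpolant. *)
Lemma gauss_exact p : (size p <= k.+1 + k.+1)%N ->
  pint (-1) 1 p = \sum_(a < k.+1) gauss_weight a * p.[xi a].
Proof.
move=> sp; rewrite {1}(divp_eq p gauss_poly) pintD gauss_orth; last first.
  by rewrite size_divp ?monic_neq0 ?gauss_poly_monic// size_gauss_poly leq_subLR.
have -> : p %% gauss_poly = interp (fun a => p.[xi a]).
  apply: interp_inj; rewrite ?size_interp//.
    by rewrite -ltnS -size_gauss_poly ltn_modp monic_neq0 ?gauss_poly_monic.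
  move=> a; rewrite interp_xi {2}(divp_eq p gauss_poly) !hornerE.
  by rewrite gauss_poly_xi mulr0 add0r.
rewrite add0r pint_sum; apply: eq_bigr => a _.
by rewrite pintZ mulrC.
Qed.

(** [nodal a ^+ 2] has degree at most [2 * k], hence is integrated exactly, and its quadrature sum
    is the weight itself. *)
Lemma gauss_weight_gt0 a : 0 < gauss_weight a.
Proof.
have n0 : nodal a != 0.
  by apply/eqP => /(congr1 (horner^~ (xi a)))/eqP; rewrite nodal_xi eqxx horner0 oner_eq0.
have -> : gauss_weight a = pint (-1) 1 (nodal a ^+ 2).
  rewrite gauss_exact.
    rewrite (bigD1 a)//= horner_exp nodal_xi eqxx expr1n mulr1 big1 ?addr0// => b ba.
    by rewrite horner_exp nodal_xi eq_sym (negbTE ba) expr0n mulr0.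
  rewrite (leq_trans (size_polyMleq _ _))// (leq_trans (leq_pred _))//.
  by rewrite leq_add// size_nodal.
rewrite lt_neqAle pint_ge0 ?andbT; [|lra|]; last first.
  by move=> x _; rewrite horner_exp sqr_ge0.
apply: contra n0 => /eqP/esym h; rewrite -sqrf_eq0; apply/eqP.
apply: (pint_eq0 _ _ h) => [|x _]; first lra.
by rewrite horner_exp sqr_ge0.
Qed.

(** If [xi a] lay outside []-1, 1[], then [('X - xi a) * q ^+ 2] would keep one sign there, yet its
    integral is that of [q * gauss_poly], which is 0. *)
Lemma gauss_point_itv a : -1 < xi a < 1.
Proof.
pose q : {poly R} := \prod_(b < k.+1 | b != a) ('X - (xi b)%:P).
have qM : gauss_poly = ('X - (xi a)%:P) * q by rewrite /gauss_poly (bigD1 a).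
have q0 : q != 0 by rewrite monic_neq0// /q -big_filter monic_prod_XsubC.
have sq : (size q <= k.+1)%N.
  by rewrite /q -big_filter size_prod_XsubC ltnS size_filter -sum1_count sum1_card cardC1 card_ord.
have := gauss_orth sq; rewrite qM mulrCA -expr2 => orth.
have nz (c : R) : c *: (('X - (xi a)%:P) * q ^+ 2) = 0 -> c = 0.
  by move/eqP; rewrite scaler_eq0 mulf_eq0 polyXsubC_eq0 sqrf_eq0 (negbTE q0) !orbF => /eqP.
have l11 : (-1 : R) < 1 by lra.
rewrite !ltNge -negb_or; apply/negP => /orP[] h.
- have := nz 1; rewrite (pint_eq0 l11 _ (etrans (pintZ _ _ _ _) _)) ?orth ?mulr0//.
    by move=> /(_ erefl)/eqP; rewrite oner_eq0.
  move=> x /andP[x1 x2].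
  rewrite hornerZ hornerM hornerXsubC horner_exp mul1r mulr_ge0 ?sqr_ge0//; lra.
- have := nz (-1); rewrite (pint_eq0 l11 _ (etrans (pintZ _ _ _ _) _)) ?orth ?mulr0//.
    by move=> /(_ erefl)/eqP; rewrite oppr_eq0 oner_eq0.
  move=> x /andP[x1 x2].
  rewrite hornerZ hornerM hornerXsubC horner_exp mulN1r oppr_ge0.
  rewrite mulr_le0_ge0 ?sqr_ge0//; lra.
Qed.

End Quadrature.
(** * Functions whose derivative has bounded variation *)

Section SlopeVariation.
Variable R : realType.
Implicit Types (u f : R -> R) (a b d x y z V K B M s T : R) (F : nat -> R -> R).

Definition lip K u := forall x y, `|u x - u y| <= K * `|x - y|.

(* [u'] has total variation at most [V] on [[a, b]]: [Phi] plays the role of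
   the variation function of [u'], and [s] that of a value of [u'] near
   [[al, be]]. *)
Definition bv_slope u a b V : Prop := exists Phi : R -> R,
  [/\ {homo Phi : x y / x <= y}, forall x y, Phi x - Phi y <= V &
    forall al be, a <= al -> al < be -> be <= b ->
    exists s, forall y z, al <= y <= be -> al <= z <= be ->
      `|u y - u z - s * (y - z)| <= (Phi be - Phi al) * `|y - z|].

Lemma bv_slopeW u a b V V' : V <= V' -> bv_slope u a b V -> bv_slope u a b V'.
Proof.
move=> VV [Phi [h1 h2 h3]]; exists Phi; split => // x y.
exact: le_trans (h2 x y) VV.
Qed.

Lemma bv_slope_total_ge0 u a b V : bv_slope u a b V -> 0 <= V.
Proof. by move=> [Phi [_ /(_ 0 0) + _]]; rewrite subrr. Qed.

Lemma bv_slopeN u a b V : bv_slope (fun x => - u x) a b V -> bv_slope u a b V.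
Proof.
move=> [Phi [h1 h2 h3]]; exists Phi; split => // al be ha hab hb.
have [s hs] := h3 _ _ ha hab hb; exists (- s) => y z hy hz.
apply: le_trans (hs y z hy hz).
have -> : u y - u z - - s * (y - z) = - (- u y - - u z - s * (y - z)) by ring.
by rewrite normrN.
Qed.

Lemma bv_slope_shift u a b V T : (forall x, u (x + T) = u x) ->
  bv_slope u a b V -> bv_slope u (a + T) (b + T) V.
Proof.
move=> uT [Phi [h1 h2 h3]]; exists (fun x => Phi (x - T)); split => //.
  by move=> x y xy; apply: h1; rewrite lerD2r.
move=> al be ha hab hb.
have [||| s hs] := h3 (al - T) (be - T); [lra|lra|lra|].
exists s => y z hy hz.
have := hs (y - T) (z - T); rewrite -(uT (y - T)) -(uT (z - T)) !subrK.
by rewrite opprB addrA subrK; apply; lra.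
Qed.

(** The derivative of [u] may jump at the junction [b]. The variation function gets an extra jump of
    [K] there, which pays for an interval straddling [b]: on it the slope 0 is taken with the bare
    Lipschitz bound. *)
Lemma bv_slope_cat u K a b d V1 V2 : lip K u -> 0 <= K -> a <= b -> b <= d ->
  bv_slope u a b V1 -> bv_slope u b d V2 -> bv_slope u a d (V1 + V2 + K).
Proof.
move=> uK K0 ab bd [P1 [m1 t1 s1]] [P2 [m2 t2 s2]].
pose P x := if x < b then P1 x else P1 b + K + (P2 x - P2 b).
have mP : {homo P : x y / x <= y}.
  move=> x y xy; rewrite /P; case: ltP => hx; case: ltP => hy.
  - exact: m1.
  - by have := m1 _ _ (ltW hx); have := m2 _ _ hy; lra.
  - lra.
  - by have := m2 _ _ xy; lra.
exists P; split => //.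
  move=> x y; have V10 := t1 0 0; have V20 := t2 0 0; rewrite /P.
  case: ltP => hx; case: ltP => hy.
  - by have := t1 x y; lra.
  - have := m1 _ _ (ltW hx); have := m2 _ _ hy; lra.
  - have := t1 b y; have := t2 x b; lra.
  - have := t2 x y; lra.
move=> al be ha hab hb; have [hbb|hbb] := ltP be b.
  have [s hs] := s1 _ _ ha hab (ltW hbb); exists s => y z hy hz.
  by rewrite /P hbb (lt_trans hab hbb) hs.
have [hal|hal] := ltP al b; last first.
  have [s hs] := s2 _ _ hal hab hb; exists s => y z hy hz.
  rewrite /P !ltNge hal hbb /=.
  by apply: le_trans (hs _ _ hy hz) _; apply: ler_wpM2r => //; lra.
exists 0 => y z hy hz; rewrite mul0r subr0 (le_trans (uK y z))//.
apply: ler_wpM2r => //; rewrite /P hal ltNge hbb /=.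
by have := m1 _ _ (ltW hal); have := m2 _ _ hbb; lra.
Qed.

Lemma lip_continuous K u : 0 <= K -> lip K u -> continuous u.
Proof.
move=> K0 uK x; apply/cvgrPdist_le => e e0.
have K1 : 0 < K + 1 by lra.
apply/nbhs_ballP; exists (e / (K + 1)) => /=; first exact: divr_gt0.
move=> y /= /ltW; rewrite ler_pdivlMr// => h.
rewrite (le_trans (uK x y))//; have := normr_ge0 (x - y); nra.
Qed.

Lemma slope_bound u f K a b s M y z : 0 <= K -> lip K u ->
  (forall x, a < x < b -> is_derive x (1 : R) u (f x)) ->
  (forall x, a < x < b -> `|f x - s| <= M) ->
  a <= y <= b -> a <= z <= b -> `|u y - u z - s * (y - z)| <= M * `|y - z|.
Proof.
move=> K0 uK du fM.
wlog zy : y z / z <= y => [H|].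
  have [zy|yz] := leP z y; first exact: H.
  move=> hy hz; have := H _ _ (ltW yz) hz hy.
  have -> : u y - u z - s * (y - z) = - (u z - u y - s * (z - y)) by ring.
  by rewrite normrN [`|y - z|]distrC.
move: zy; rewrite le_eqVlt => /predU1P[->|zy] hy hz.
  by rewrite !subrr mulr0 subr0 normr0 mulr0.
have duz x : x \in `]z, y[ -> is_derive x (1 : R) u (f x).
  by rewrite in_itv/= => hx; apply: du; lra.
have [|c] := MVT zy duz; first exact/continuous_subspaceT/lip_continuous/uK.
rewrite in_itv/= => hc ->; rewrite -mulrBl normrM ler_wpM2r// fM//; lra.
Qed.

Lemma deriv_le_lip u K x df : 0 <= K -> lip K u ->
  is_derive x (1 : R) u df -> `|df| <= K.
Proof.
move=> K0 uK [du <-].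
apply: (ler_cvg_to (cvg_norm du) (cvg_cst K)).
near=> h; have h0 : h != 0 by near: h; exact: nbhs_dnbhs_neq.
rewrite /= normrM normfV ler_pdivrMl ?normr_gt0// mulrC.
by rewrite (le_trans (uK _ _))//= addrK [h *: _]mulr1.
Unshelve. all: by end_near. Qed.

Lemma mvt_segment f df a b : a < b ->
  (forall x, a <= x <= b -> is_derive x (1 : R) f (df x)) ->
  exists2 x, a < x < b & f b - f a = df x * (b - a).
Proof.
move=> ab dff.
have dfab x : x \in `]a, b[ -> is_derive x (1 : R) f (df x).
  by rewrite in_itv/= => hx; apply: dff; lra.
have [|x] := MVT ab dfab; last by rewrite in_itv/= => hx e; exists x.
apply: derivable_within_continuous => x; rewrite in_itv/= => hx.
exact: (@ex_derive _ _ _ _ _ _ _ (dff x hx)).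
Qed.

(** A family of successive derivatives in place of [derive1n], so that [- u] has the chain of the
    [- F i] and inductions on the order can change sign freely. *)
Definition deriv_chain (n : nat) F a b := forall i, (i < n)%N ->
  forall x, a < x < b -> is_derive x (1 : R) (F i) (F i.+1 x).

Lemma deriv_chainS n F a b a' b' : a <= a' -> b' <= b ->
  deriv_chain n F a b -> deriv_chain n F a' b'.
Proof. by move=> aa bb h i hi x hx; apply: h => //; lra. Qed.

Lemma deriv_chainN n F a b : deriv_chain n F a b ->
  deriv_chain n (fun i x => - F i x) a b.
Proof. by move=> h i hi x hx; have := h i hi x hx; exact: is_deriveN. Qed.

Lemma chain_nondecreasing n F a b i x y : deriv_chain n F a b -> (i < n)%N ->
  (forall x, a < x < b -> 0 <= F i.+1 x) -> a < x -> x <= y -> y < b ->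
  F i x <= F i y.
Proof.
move=> hF hi F0 ax; rewrite le_eqVlt => /predU1P[->//|xy] yb.
have [|c hc e] := @mvt_segment (F i) (F i.+1) x y xy.
  by move=> z hz; apply: hF => //; lra.
by rewrite -subr_ge0 e mulr_ge0 ?F0//; lra.
Qed.

(** The derivative is nondecreasing with values in [[-K, K]] and serves as its own variation
    function. Extending it by [-K] on the left and [K] on the right also covers intervals that touch
    [a] or [b], where it need not exist. *)
Lemma chain_monotone n F a b K : deriv_chain n F a b -> (1 < n)%N -> a < b ->
  0 <= K -> lip K (F 0%N) -> (forall x, a < x < b -> 0 <= F 2%N x) ->
  bv_slope (F 0%N) a b (2 * K).
Proof.
move=> hF n1 ab K0 uK F2; have n0 : (0 < n)%N by exact: ltn_trans n1.
have F1K x : a < x < b -> -K <= F 1%N x <= K.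
  by move=> hx; rewrite -ler_norml; apply: (deriv_le_lip K0 uK); exact: hF.
pose P x := if x <= a then - K else if b <= x then K else F 1%N x.
have PE x : a < x < b -> P x = F 1%N x.
  by move=> /andP[ax xb]; rewrite /P !leNgt ax xb.
have PK x : - K <= P x <= K.
  rewrite /P; case: (leP x a) => ax; first by lra.
  case: (leP b x) => xb; first by lra.
  by apply: F1K; rewrite ax xb.
have mP : {homo P : x y / x <= y}.
  move=> x y xy; have [xa|ax] := leP x a.
    by rewrite {1}/P xa; have /andP[] := PK y.
  have [yb|yb] := leP b y.
    by rewrite {2}/P yb [y <= a]leNgt (lt_le_trans ax xy)/=; have /andP[] := PK x.
  rewrite !PE ?ax ?yb ?(le_lt_trans xy yb) ?(lt_le_trans ax xy)//.
  exact: (chain_nondecreasing hF n1 F2).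
exists P; split => // [x y|al be ha hab hb].
  by have := PK x; have := PK y; lra.
exists (F 1%N ((al + be) / 2)) => y z hy hz.
apply: (slope_bound K0 uK) hy hz => x hx; first by apply: hF => //; lra.
rewrite -!PE; [|lra|lra].
have := mP al x; have := mP x be; have := mP al ((al + be) / 2).
have := mP ((al + be) / 2) be.
move=> /(_ ltac:(lra)) h1 /(_ ltac:(lra)) h2 /(_ ltac:(lra)) h3 /(_ ltac:(lra)) h4.
by rewrite ler_norml; lra.
Qed.

Lemma chain_lip n F a b B i x y : deriv_chain n F a b -> (i < n)%N ->
  (forall x, a < x < b -> `|F i.+1 x| <= B) -> a < x < b -> a < y < b ->
  `|F i x - F i y| <= B * `|x - y|.
Proof.
move=> hF hi FB; wlog yx : x y / y <= x => [H|] hx hy.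
  have [|/ltW] := leP y x => h; first exact: H.
  by rewrite distrC [`|x - y|]distrC; exact: H.
move: yx; rewrite le_eqVlt => /predU1P[->|yx].
  by rewrite !subrr normr0 mulr0.
have [|c hc ->] := @mvt_segment (F i) (F i.+1) y x yx.
  by move=> z hz; apply: hF => //; lra.
by rewrite normrM ler_wpM2r// FB//; lra.
Qed.

(** The variation function is [B * x], clamped to [[a, b]] so that its total increment is at most
    [B * (b - a) <= B]. *)
Lemma chain_bounded n F a b K B : deriv_chain n F a b -> (1 < n)%N -> a < b ->
  b - a <= 1 -> 0 <= K -> 0 <= B -> lip K (F 0%N) ->
  (forall x, a < x < b -> `|F 2%N x| <= B) -> bv_slope (F 0%N) a b B.
Proof.
move=> hF n1 ab ab1 K0 B0 uK F2; have n0 : (0 < n)%N by exact: ltn_trans n1.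
pose cl x := Num.max a (Num.min b x).
have clE x : a <= x <= b -> cl x = x.
  by move=> /andP[ax xb]; rewrite /cl min_r// max_r.
have cl_itv x : a <= cl x <= b by rewrite /cl le_max lexx ge_max (ltW ab) ge_min lexx.
exists (fun x => B * cl x); split => [x y xy|x y|al be ha hab hb].
- rewrite ler_wpM2l// /cl ge_max !le_max lexx/=.
  by case: (leP b x) => bx; case: (leP b y) => b_y; lra.
- rewrite -mulrBr ler_piMr//; have := cl_itv x; have := cl_itv y; lra.
- exists (F 1%N ((al + be) / 2)) => y z hy hz; rewrite !clE; [|lra|lra].
  apply: (slope_bound K0 uK) hy hz => x hx; first by apply: hF => //; lra.
  have hm : al < (al + be) / 2 < be by lra.
  set m := (al + be) / 2 in hm *.
  rewrite -mulrBr.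
  rewrite (le_trans (chain_lip hF n1 F2 _ _))//; [lra|lra|].
  rewrite ler_wpM2l// ler_norml; lra.
Qed.

(* [F m.+1] is nondecreasing, so it changes sign at most once: split there and
   descend to a lower derivative on both sides. *)
Lemma bv_slope_ge0 K m : 0 <= K -> exists V, forall n F a b,
  deriv_chain n F a b -> (m.+1 < n)%N -> a < b -> lip K (F 0%N) ->
  (forall x, a < x < b -> 0 <= F m.+2 x) -> bv_slope (F 0%N) a b V.
Proof.
move=> K0; elim: m => [|m [V IH]].
  by exists (2 * K) => n F a b hF n1 ab uK F2; exact: (chain_monotone hF n1).
exists (V + V + K) => n F a b hF mn ab uK F2.
have IHN a' b' : a <= a' -> b' <= b -> a' < b' ->
    (forall x, a' < x < b' -> F m.+2 x <= 0) -> bv_slope (F 0%N) a' b' V.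
  move=> aa bb ab' F0; apply: bv_slopeN.
  apply: (IH n (fun i x => - F i x)) => //.
  - exact/deriv_chainN/(deriv_chainS aa bb hF).
  - exact: ltnW.
  - by move=> x y; rewrite -opprD normrN.
  - by move=> x hx; rewrite oppr_ge0 F0.
have IHP a' b' : a <= a' -> b' <= b -> a' < b' ->
    (forall x, a' < x < b' -> 0 <= F m.+2 x) -> bv_slope (F 0%N) a' b' V.
  move=> aa bb ab' F0; apply: (IH n) => //; last exact: ltnW.
  exact: (deriv_chainS aa bb hF).
have mono x y : a < x -> x <= y -> y < b -> F m.+2 x <= F m.+2 y.
  exact: (chain_nondecreasing hF mn F2).
have [Fp|/existsNP[x0 /not_implyP[x0ab /negP]]] :=
    pselect (forall x, a < x < b -> 0 <= F m.+2 x).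
  have h := IHP a b (lexx _) (lexx _) ab Fp.
  by apply: (bv_slopeW _ h); have := bv_slope_total_ge0 h; lra.
rewrite -ltNge => Fx0.
have [Fn|/existsNP[x1 /not_implyP[x1ab /negP]]] :=
    pselect (forall x, a < x < b -> F m.+2 x <= 0).
  have h := IHN a b (lexx _) (lexx _) ab Fn.
  by apply: (bv_slopeW _ h); have := bv_slope_total_ge0 h; lra.
rewrite -ltNge => Fx1.
have x01 : x0 <= x1.
  by rewrite leNgt; apply/negP => x10; have := mono x1 x0; lra.
have [||s] := @IVT _ (F m.+2) x0 x1 0 x01.
- apply: derivable_within_continuous => w; rewrite in_itv/= => hw.
  by have [] := hF m.+2 mn w ltac:(lra).
- by rewrite ge_min le_max (ltW Fx0) (ltW Fx1) orbT.
rewrite in_itv/= => hs Fs.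
apply: (bv_slope_cat uK K0 (b := s)); [lra|lra| |].
- apply: IHN => [|||x hx]; [lra|lra|lra|].
  by rewrite -Fs mono//; lra.
- apply: IHP => [|||x hx]; [lra|lra|lra|].
  by rewrite -Fs mono//; lra.
Qed.

(* On an interval of length at most 1, [F m.+1] varies by at most [B]: either it
   is bounded by [2 * B], or it has a constant sign. *)
Lemma bv_slope_bounded K m : 0 <= K -> forall B, 0 <= B ->
  exists V, forall n F a b,
  deriv_chain n F a b -> (m.+1 < n)%N -> a < b -> b - a <= 1 -> lip K (F 0%N) ->
  (forall x, a < x < b -> `|F m.+2 x| <= B) -> bv_slope (F 0%N) a b V.
Proof.
move=> K0; elim: m => [|m IH] B B0.
  by exists B => n F a b hF n1 ab ab1 uK F2; exact: (chain_bounded hF n1 ab ab1 K0 B0 uK).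
have [|V1 IH1] := IH (2 * B); first lra.
have [V2 IH2] := bv_slope_ge0 m K0.
exists (Num.max V1 V2) => n F a b hF mn ab ab1 uK FB.
pose c := (a + b) / 2.
have hc : a < c < b by rewrite /c; lra.
have Fc x : a < x < b -> `|F m.+2 x - F m.+2 c| <= B.
  move=> hx; rewrite (le_trans (chain_lip hF mn FB hx hc))//.
  by rewrite ler_piMr// ler_norml; lra.
have [FcB|FcB] := leP `|F m.+2 c| B.
  apply: (@bv_slopeW _ _ _ V1); first by rewrite le_max lexx.
  apply: (IH1 n) => //; first exact: ltnW.
  move=> x /Fc; move: FcB; rewrite !ler_norml; lra.
apply: (@bv_slopeW _ _ _ V2); first by rewrite le_max lexx orbT.
have [F0|F0] := leP 0 (F m.+2 c).
  apply: (IH2 n) => //; first exact: ltnW.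
  move=> x /Fc; move: FcB; rewrite ger0_norm// ler_norml; lra.
apply: bv_slopeN; apply: (IH2 n (fun i x => - F i x)) => //.
- exact: deriv_chainN.
- exact: ltnW.
- by move=> x y; rewrite -opprD normrN.
- move=> x /Fc; move: FcB; rewrite ltr0_norm// ler_norml; lra.
Qed.

Lemma bv_slope_iter u V K m : 0 <= K -> lip K u -> (forall x, u (x + 1) = u x) ->
  forall a, bv_slope u a (a + 1) V -> bv_slope u a (a + m.+1%:R) ((V + K) * m.+1%:R).
Proof.
move=> K0 uK u1 a ha; have V0 := bv_slope_total_ge0 ha.
elim: m => [|m IH]; first by apply: bv_slopeW ha; lra.
have um x : u (x + m.+1%:R) = u x.
  elim: m.+1 => [|i IHi]; first by rewrite addr0.
  by rewrite -natr1 addrA u1.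
have m0 : 0 <= m.+1%:R :> R by [].
have := bv_slope_shift um ha; rewrite addrAC => h.
have := bv_slope_cat uK K0 _ _ IH h; rewrite -addrA natr1 => /(_ _ _)/bv_slopeW.
apply; [lra| |rewrite -natr1; lra].
by rewrite -natr1; lra.
Qed.

Lemma ae_itv_witness (P : R -> Prop) a b :
  {ae @lebesgue_measure R, forall x, x \in `]0, 1[ -> P x} ->
  0 <= a -> a < b -> b <= 1 -> exists2 x, a < x < b & P x.
Proof.
move=> [N [mN N0 hN]] a0 ab b1; apply: contrapT => H.
have : (@lebesgue_measure R `]a, b[ <= 0)%E.
  rewrite -N0; apply: le_measure; rewrite ?inE//=.
  move=> x /=; rewrite in_itv/= => hx; apply: hN => /= h; apply: H.
  by exists x => //; apply: h; rewrite in_itv/=; lra.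
by rewrite lebesgue_measure_itv/= lte_fin ab lee_fin; apply/negP; lra.
Qed.

(** By continuity, a violation at [x] would persist on a small interval of positive measure. This
    serves for the derivative of order [l + 1] of the solution and for the traces of polynomials at
    the interfaces. *)
Lemma Linfty_le_closure f g M a b x : Linfty_le f M -> 0 <= a -> b <= 1 -> a < b ->
  (forall y, a < y < b -> f y = g y) -> a <= x <= b ->
  {for x, continuous g} -> `|g x| <= M.
Proof.
move=> fM a0 b1 ab fg hx gc; rewrite leNgt; apply/negP => Mg.
have [e /= e0 he] : nbhs_ball x (fun y => M < `|g y|).
  apply/nbhs_ballP.
  exact: (cvgr_gt _ (cvg_norm gc)).
have [|||y hy] := ae_itv_witness (a := Num.max a (x - e)) (b := Num.min b (x + e)) fM.
- by rewrite le_max a0.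
- by rewrite gt_max !lt_min; lra.
- by rewrite ge_min b1.
rewrite fg; last by move: hy; rewrite gt_max !lt_min; lra.
apply/negP; rewrite -ltNge; apply: he; rewrite -ball_normE /= ltr_norml.
by move: hy; rewrite gt_max !lt_min; lra.
Qed.

(** Induction on the number of breakpoints: one lying inside splits the interval, at the cost
    [V + V + K]. The constant is chosen before [u] and the interval, which makes it uniform in
    time. *)
Lemma bv_slope_breakpoints K l (c0 : R) N : (1 <= l)%N -> 0 <= K -> exists V,
  forall (s : seq R) u a b, (size s <= N)%N -> 0 <= a -> a < b -> b <= 1 -> lip K u ->
  Linfty_le (derive1n l.+1 u) c0 ->
  (forall x, a < x < b -> x \in s \/ Cm_near l.+1 u x) -> bv_slope u a b V.
Proof.
case: l => // l _ K0; have [V0 H0] := bv_slope_bounded l K0 (normr_ge0 c0).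
elim: N => [|N [V IH]].
  exists V0 => s u a b; rewrite leqn0 size_eq0 => /eqP -> a0 ab b1 uK uc hreg.
  have {}hreg x : a < x < b -> Cm_near l.+2 u x by move=> /hreg[].
  apply: (H0 l.+2 (fun i => derive1n i u)) => //; last 2 first.
  - lra.
  - move=> x hx; have [_ uxc] := nbhs_singleton (hreg x hx).
    apply: le_trans (ler_norm _); apply: (Linfty_le_closure (a := 0) (b := 1) uc) => //; lra.
  move=> i il x hx; have [/(_ i il) dx _] := nbhs_singleton (hreg x hx).
  by rewrite derive1nS derive1E; exact: derivableP.
exists (V + V + K) => -[|c s] u a b sN a0 ab b1 uK uc hreg.
  have h := IH [::] u a b isT a0 ab b1 uK uc hreg.
  by apply: (bv_slopeW _ h); have := bv_slope_total_ge0 h; lra.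
have red a' b' : a <= a' -> b' <= b -> ~~ (a' < c < b') ->
    forall x, a' < x < b' -> x \in s \/ Cm_near l.+2 u x.
  move=> aa bb hc x hx; have [|+|] := hreg x; [lra| |by right].
  by rewrite inE => /predU1P[xc|]; [rewrite -xc hx in hc|left].
have [hc|hc] := boolP (a < c < b).
  apply: (bv_slope_cat uK K0 (b := c)); [lra|lra| |].
  - by apply: (IH s) => //; [lra|lra|apply: red; lra].
  - by apply: (IH s) => //; [lra|lra|apply: red; lra].
have h : bv_slope u a b V by apply: (IH s) => //; apply: red.
by apply: (bv_slopeW _ h); have := bv_slope_total_ge0 h; lra.
Qed.

(** Since [mesh_size m <= 1], the interval [[-2, 3]] contains every patch of radius
    [2 * mesh_size m] around a point of [[0, 1]]; periodicity reduces its five periods to one. *)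
Lemma piecewise_class_bv_slope K l p L (c0 : R) : (1 <= l)%N -> 0 <= K ->
  exists V, forall u, lip K u -> (forall x, u (x + 1) = u x) ->
  piecewise_class l p L c0 u -> bv_slope u (-2) 3 V.
Proof.
move=> l1 K0; have [V HV] := bv_slope_breakpoints c0 p l1 K0.
exists ((V + K) * 5) => u uK u1 [_ _ up uc].
have um2 x : u (x + -2) = u x.
  by rewrite -(u1 (x + -2)) -(u1 (x + -2 + 1)); congr u; ring.
have -> : 3 = (-2) + 5 :> R by ring.
apply: bv_slope_iter => //.
have := @bv_slope_shift u 0 1 V (-2) um2; rewrite add0r [1 + _]addrC; apply.
apply: (HV (finmap.enum_fset (fset_set (nonregular_points l.+1 u)))) => //.
  exact: geq_card_fset_set.
move=> x hx; have [|nx] := pselect (Cm_near l.+1 u x); [by right|left].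
have fin : finite_set (nonregular_points l.+1 u).
  by apply/finite_set_leP; exists p.
have -> : (x \in finmap.enum_fset (fset_set (nonregular_points l.+1 u)))
    = (x \in nonregular_points l.+1 u) by exact: in_fset_set.
by rewrite inE; split => //; rewrite in_itv/=; lra.
Qed.

(** The windows starting at the [y j + r] overlap. Each is cut into [m] slices of length [eta]; for
    a fixed slice number the slices of successive [j] do not overlap, so their increments telescope
    to at most [V]. *)
Lemma increment_sum (Phi : R -> R) V (eta : R) N (y : nat -> R) m r :
  {homo Phi : x y / x <= y} -> (forall x y, Phi x - Phi y <= V) ->
  (forall j, (j < N)%N -> y j + eta <= y j.+1) ->
  \sum_(j < N) (Phi (y j + r + m%:R * eta) - Phi (y j + r)) <= m%:R * V.
Proof.
move=> mP PV hy; elim: m => [|m IH].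
  by rewrite !mul0r big1// => j _; rewrite addr0 subrr.
pose P' j := Phi (y j + r + m%:R * eta).
rewrite (eq_bigr (fun j : 'I_N => (P' j - Phi (y j + r))
    + (Phi (y j + r + m.+1%:R * eta) - P' j))) => [|j _]; last by ring.
rewrite big_split/= -[in leRHS]natr1 [leRHS]mulrDl mul1r lerD//.
apply: le_trans (PV (y N + r + m%:R * eta) (y 0%N + r + m%:R * eta)).
rewrite -(telescope_sumr (fun j => Phi (y j + r + m%:R * eta)))// big_mkord.
apply: ler_sum => j _; rewrite lerD2r mP// -natr1 mulrDl mul1r.
by have := hy j (ltn_ord j); lra.
Qed.

End SlopeVariation.
(** * The exact solution *)

Section ExactSolutionProperties.
Variables (R : realType) (c : R) (hc : 0 < c).
Implicit Types (u g : R -> R) (t s x y K d : R).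

Lemma lipschitz_lip u : lipschitz u -> exists2 K, 0 <= K & lip K u.
Proof.
move=> [M [_ hM]]; exists (Num.max 0 (M + 1)); first by rewrite le_max lexx.
move=> x y; have := hM (Num.max 0 (M + 1)).
rewrite lt_max ltrDl ltr01 orbT => /(_ isT) /(_ (x, y)); exact.
Qed.

Section Window.
Variables (g : R -> R) (Kg : R).
Hypotheses (Kg0 : 0 <= Kg) (gK : lip Kg g).

Lemma obstacle_maxP t x : 0 <= t -> exists2 th, 0 <= th <= t &
  obstacle_max c g t x = g (x - c * th) /\
  forall th', 0 <= th' <= t -> g (x - c * th') <= g (x - c * th).
Proof.
move=> t0; have [|th] := @EVT_max _ (fun th => g (x - c * th)) 0 t t0.
  apply: continuous_subspaceT; apply: (@lip_continuous _ (Kg * c)).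
    by rewrite mulr_ge0// ltW.
  move=> a b; rewrite (le_trans (gK _ _))//.
  rewrite opprD addrACA subrr add0r -opprD -mulrBr normrN normrM (gtr0_norm hc).
  by rewrite mulrA.
rewrite in_itv/= => hth hmax; exists th => //; split => [|th' h]; last first.
  by apply: hmax; rewrite in_itv.
apply/eqP; rewrite eq_le; apply/andP; split.
  apply: ge_sup; first by exists (g (x - c * 0)); exists 0 => //=; rewrite in_itv/= lexx.
  by move=> _ /= [a ha <-]; exact: hmax.
apply: ub_le_sup; last by exists th => //=; rewrite in_itv.
by exists (g (x - c * th)) => _ /= [a ha <-]; exact: hmax.
Qed.

Lemma obstacle_max_ge t x th : 0 <= th <= t -> g (x - c * th) <= obstacle_max c g t x.
Proof.
move=> h; have t0 : 0 <= t by lra.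
by have [th0 _ [-> hmax]] := obstacle_maxP x t0; exact: hmax.
Qed.

Lemma obstacle_max_le t x B : 0 <= t ->
  (forall th, 0 <= th <= t -> g (x - c * th) <= B) -> obstacle_max c g t x <= B.
Proof. by move=> t0 hB; have [th /hB h [-> _]] := obstacle_maxP x t0. Qed.

Lemma obstacle_max_lip t : 0 <= t -> lip Kg (obstacle_max c g t).
Proof.
move=> t0; have half x y : obstacle_max c g t x - obstacle_max c g t y <= Kg * `|x - y|.
  rewrite lerBlDr; apply: obstacle_max_le => // th hth.
  have := obstacle_max_ge y hth; have := gK (x - c * th) (y - c * th).
  by rewrite (_ : _ - _ - _ = x - y) ?ler_norml; [lra|ring].
move=> x y; rewrite ler_norml half andbT lerNl opprB.
by rewrite distrC.
Qed.

Lemma obstacle_max_periodic t x : 0 <= t -> periodic g 1 ->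
  obstacle_max c g t (x + 1) = obstacle_max c g t x.
Proof.
move=> t0 g1; congr sup; rewrite eqEsubset.
by split => _ /= [th hth <-]; exists th => //; rewrite addrAC g1.
Qed.

Lemma obstacle_maxD t s x : 0 <= t -> 0 <= s ->
  obstacle_max c g (t + s) x
  = Num.max (obstacle_max c g t (x - c * s)) (obstacle_max c g s x).
Proof.
move=> t0 s0; apply/eqP; rewrite eq_le ge_max; apply/and3P; split.
- apply: obstacle_max_le => [|th hth]; first lra.
  rewrite le_max; have [ts|st] := leP th s.
    by apply/orP; right; apply: obstacle_max_ge; lra.
  apply/orP; left; have -> : x - c * th = x - c * s - c * (th - s) by ring.
  by apply: obstacle_max_ge; lra.
- apply: obstacle_max_le => // th hth.
  have -> : x - c * s - c * th = x - c * (th + s) by ring.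
  by apply: obstacle_max_ge; lra.
- by apply: obstacle_max_le => // th hth; apply: obstacle_max_ge; lra.
Qed.

Section Solution.
Variables (u0 : R -> R) (K0 : R).
Hypothesis u0K : lip K0 u0.
Let u := exact_solution c u0 g.

(** The dynamic programming principle, of which the scheme is a discretisation. Only [s] has to be
    positive, so the step out of [t = 0] is covered. *)
Lemma exact_solutionD t s x : 0 <= t -> 0 < s ->
  u (t + s) x = Num.max (u t (x - c * s)) (obstacle_max c g s x).
Proof.
move=> t0 s0; rewrite /u /exact_solution [t + s == 0]gt_eqF; last lra.
have [->|tn0] := eqVneq t 0; first by rewrite add0r.
rewrite obstacle_maxD ?(ltW s0)// maxA; congr (Num.max (Num.max (u0 _) _) _); ring.
Qed.

Lemma exact_solution_ge t x : 0 < t -> g x <= u t x.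
Proof.
move=> t0; rewrite /u /exact_solution gt_eqF// le_max; apply/orP; right.
rewrite -{1}(subr0 x) -(mulr0 c); apply: obstacle_max_ge; lra.
Qed.

Lemma exact_solution_lip t : 0 <= t -> lip (Num.max K0 Kg) (u t).
Proof.
move=> t0 x y; rewrite /u /exact_solution; case: eqP => _.
  by rewrite (le_trans (u0K _ _))// ler_wpM2r// le_max lexx.
have h1 : `|u0 (x - c * t) - u0 (y - c * t)| <= Num.max K0 Kg * `|x - y|.
  apply: (le_trans (u0K _ _)); rewrite (_ : _ - _ - _ = x - y); last ring.
  by rewrite ler_wpM2r// le_max lexx.
have h2 : `|obstacle_max c g t x - obstacle_max c g t y| <= Num.max K0 Kg * `|x - y|.
  by rewrite (le_trans (obstacle_max_lip t0 _ _))// ler_wpM2r// le_max lexx orbT.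
move: h1 h2; set M := Num.max K0 Kg * _; rewrite !ler_norml.
case: (leP (u0 (x - c * t)) (obstacle_max c g t x)) => hx;
  by case: (leP (u0 (y - c * t)) (obstacle_max c g t y)) => hy; lra.
Qed.

Lemma exact_solution_periodic t x : 0 <= t -> periodic u0 1 -> periodic g 1 ->
  u t (x + 1) = u t x.
Proof.
move=> t0 p0 pg; rewrite /u /exact_solution; case: eqP => _; first exact: p0.
by rewrite addrAC p0 obstacle_max_periodic.
Qed.

(** The Lipschitz bound is meant for the first time step: incurred at every step it would add up to
    [O(1)]. *)
Lemma gtilde_bounds rule s x : 0 < s ->
  [/\ gtilde rule c g s x <= obstacle_max c g s x,
      obstacle_max c g s x - gtilde rule c g s x <= Kg * (c * s) &
      rule = WindowMax -> gtilde rule c g s x = obstacle_max c g s x].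
Proof.
move=> s0; have cs0 : 0 <= Kg * (c * s) by rewrite !mulr_ge0// ltW.
case: rule => /=; first by split => //; lra.
have gx : g x <= obstacle_max c g s x.
  by rewrite -{1}(subr0 x) -(mulr0 c); apply: obstacle_max_ge; lra.
split => //; first by rewrite ge_max gx/=; apply: obstacle_max_ge; lra.
rewrite lerBlDr; apply: obstacle_max_le => [|th hth]; first exact: ltW.
have := gK (x - c * th) x; rewrite ler_norml => /andP[_].
rewrite addrAC subrr add0r normrN normrM (gtr0_norm hc) ger0_norm; last lra.
have : Kg * (c * th) <= Kg * (c * s).
  by rewrite ler_wpM2l// ler_pM2l//; lra.
have : g x <= Num.max (g x) (g (x - c * s)) by rewrite le_max lexx.
lra.
Qed.

(* Assume an interior maximiser [y] of [g] beats both endpoints. Then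
   [u (t + s)] is at least its value at [x] on the two sides of [x], so its
   slope near [x] is at most [tau]; this propagates [g y] to a point [z]
   upwind of [x - c * s], while [u t y >= g y] on the other side, whence a
   lower bound for [u t] at [x - c * s]. *)
Lemma endpoint_consistency t s x (al be su sU tau : R) :
  0 < t -> 0 < s -> 0 <= tau ->
  al <= x - 2 * (c * s) -> x + c * s <= be ->
  (forall y z, al <= y <= be -> al <= z <= be ->
     `|u t y - u t z - su * (y - z)| <= tau * `|y - z|) ->
  (forall y z, al <= y <= be -> al <= z <= be ->
     `|u (t + s) y - u (t + s) z - sU * (y - z)| <= tau * `|y - z|) ->
  u (t + s) x - Num.max (u t (x - c * s)) (Num.max (g x) (g (x - c * s)))
    <= 3 * (c * s) * tau.
Proof.
move=> t0 s0 tau0 hal hbe hu hU; have d0 : 0 < c * s by rewrite mulr_gt0.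
have dtau : 0 <= c * s * tau by rewrite mulr_ge0// ltW.
set d := c * s in hal hbe d0 dtau *.
rewrite lerBlDr exact_solutionD ?(ltW t0)// -/d.
set M := Num.max (u t (x - d)) (Num.max _ _).
have uM : u t (x - d) <= M by rewrite le_max lexx.
have gM : g x <= M by rewrite !le_max lexx orbT.
have gdM : g (x - d) <= M by rewrite !le_max lexx !orbT.
rewrite ge_max; apply/andP; split; first lra.
have [th hth [omE gmax]] := obstacle_maxP x (ltW s0).
rewrite omE; set y := x - c * th in omE gmax *.
have [|yM] := leP (g y) M; first lra.
have yx : y < x.
  rewrite lt_neqAle; apply/andP; split; last first.
    by rewrite /y lerBlDr lerDl mulr_ge0 ?(ltW hc)//; lra.
  by apply: contraTneq yM => ->; rewrite -leNgt.
have xdy : x - d < y.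
  rewrite lt_neqAle; apply/andP; split; last first.
    rewrite /y /d lerD2l lerN2 ler_pM2l//; lra.
  by apply: contraTneq yM => <-; rewrite -leNgt.
have UE : u (t + s) x = g y.
  by rewrite exact_solutionD ?(ltW t0)// omE max_r// -/d; lra.
have Uge w : y <= w -> w <= y + d -> g y <= u (t + s) w.
  move=> yw wy; rewrite exact_solutionD ?(ltW t0)// le_max; apply/orP; right.
  have -> : y = w - c * ((w - y) / c) by rewrite mulrCA mulfV ?gt_eqF//; ring.
  apply: obstacle_max_ge; rewrite divr_ge0 ?(ltW hc)//=; last lra.
  rewrite ler_pdivrMr// mulrC -/d; lra.
have sUle : sU <= tau.
  have := hU x y ltac:(lra) ltac:(lra); rewrite [`|x - y|]gtr0_norm ?subr_gt0//.
  have := Uge y (lexx _) ltac:(lra); rewrite ler_norml UE; nra.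
have sUge : - tau <= sU.
  have := hU (y + d) x ltac:(lra) ltac:(lra).
  rewrite [`|y + d - x|]gtr0_norm; last lra.
  have := Uge (y + d) ltac:(lra) (lexx _); rewrite ler_norml UE; nra.
have Uxd : g y - 2 * d * tau <= u (t + s) (x - d).
  have := hU (x - d) x ltac:(lra) ltac:(lra); rewrite ler_norml UE.
  have -> : x - d - x = - d by ring.
  rewrite normrN gtr0_norm//; nra.
have [z hz uz] : exists2 z, x - 2 * d <= z <= x - d & u (t + s) (x - d) <= u t z.
  rewrite exact_solutionD ?(ltW t0)// -/d.
  case: leP => _; last by exists (x - d - d) => //; lra.
  have [th' hth' [-> _]] := obstacle_maxP (x - d) (ltW s0).
  exists (x - d - c * th'); last exact: exact_solution_ge.
  have : c * th' <= d by rewrite /d ler_pM2l//; lra.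
  have : 0 <= c * th' by rewrite mulr_ge0 ?(ltW hc)//; lra.
  lra.
have uy := exact_solution_ge y t0.
(* The sign of [su] selects the point from which [u t] cannot fall much towards [x - d]: [z] on the
   left or [y] on the right. The comparison costs at most [d * tau]; with the [2 * d * tau] of [Uxd]
   this gives the constant 3. *)
have [su0|su0] := leP 0 su.
- have := hu (x - d) z ltac:(lra) ltac:(lra).
  rewrite [`|x - d - z|]ger0_norm; last lra.
  have : 0 <= x - d - z <= d by lra.
  rewrite ler_norml; nra.
- have := hu (x - d) y ltac:(lra) ltac:(lra).
  rewrite [`|x - d - y|]ltr0_norm; last lra.
  have : 0 <= y - (x - d) <= d by lra.
  rewrite ler_norml; nra.
Qed.

End Solution.
End Window.
End ExactSolutionProperties.
(** * Broken polynomials and the discontinuous Galerkin form *)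

Section ScalarForms.
Variable R : realType.
Implicit Types (x y z : R).

Lemma psd_cauchy_schwarz x y z :
  (forall s t, 0 <= s ^+ 2 * x + 2 * s * t * y + t ^+ 2 * z) -> y ^+ 2 <= x * z.
Proof.
move=> H; have z0 : 0 <= z by have := H 0 1; lra.
have x0 : 0 <= x by have := H 1 0; lra.
move: z0; rewrite le_eqVlt => /predU1P[z0|z0].
  have [->|yn] := eqVneq y 0; first by rewrite expr0n mulr_ge0// -z0.
  (* For [z = 0] and [s = 1] the form is affine in [t]; this [t] gives it the value [- x - 2]. *)
  have := H 1 (- (x + 1) / y); rewrite -z0 mulr0 addr0 expr1n mul1r mulr1.
  have -> : 2 * (- (x + 1) / y) * y = - 2 * (x + 1) by field.
  by lra.
have := H z (- y).
have -> : z ^+ 2 * x + 2 * z * - y * y + (- y) ^+ 2 * z = z * (x * z - y ^+ 2) by ring.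
by rewrite pmulr_rge0// subr_ge0.
Qed.

Lemma sqr_le_norm x y z : 0 <= x -> 0 <= z -> y ^+ 2 <= x * z ->
  `|y| <= Num.sqrt x * Num.sqrt z.
Proof. by move=> x0 z0 h; rewrite -sqrtr_sqr -sqrtrM// ler_sqrt// mulr_ge0. Qed.

Lemma sum_cauchy_schwarz (I : finType) (f g : I -> R) :
  `|\sum_i f i * g i|
  <= Num.sqrt (\sum_i f i ^+ 2) * Num.sqrt (\sum_i g i ^+ 2).
Proof.
have s0 (e : I -> R) : 0 <= \sum_i e i ^+ 2 by apply: sumr_ge0 => i _; exact: sqr_ge0.
apply: sqr_le_norm => //; apply: psd_cauchy_schwarz => s t.
rewrite (_ : _ + _ = \sum_i (s * f i + t * g i) ^+ 2)//.
rewrite !mulr_sumr -!big_split; apply: eq_bigr => i _ /=; ring.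
Qed.

Lemma sum_sqr_le (I : finType) (f : I -> R) : (forall i, 0 <= f i) ->
  \sum_i f i ^+ 2 <= (\sum_i f i) ^+ 2.
Proof.
move=> f0; rewrite expr2 mulr_suml; apply: ler_sum => i _.
rewrite expr2 ler_wpM2l// (bigD1 i)//= lerDl; exact: sumr_ge0.
Qed.

Lemma max_nonexpansive x y z : `|Num.max x z - Num.max y z| <= `|x - y|.
Proof.
rewrite ler_norml; have := ler_norm (x - y); have := ler_norm (- (x - y)).
by rewrite normrN; case: (leP x z) => h1; case: (leP y z) => h2; lra.
Qed.

End ScalarForms.

Section BrokenPolynomials.
Variables (R : realType) (m : mesh R).
Local Notation N := (ncells m).
Local Notation BP := (broken_poly m).
Implicit Types (v w phi psi y z : BP) (j : 'I_N) (k : nat).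

Local Notation lft j := (node m (nat_of_ord j)).
Local Notation rgt j := (node m (nat_of_ord j).+1).

Lemma cell_lt j : lft j < rgt j. Proof. exact: node_lt. Qed.

Lemma cell_size_gt0 j : 0 < cell_size j.
Proof. by rewrite subr_gt0 cell_lt. Qed.

Lemma sum_cell_size : \sum_(j < N) cell_size j = 1.
Proof.
rewrite -(big_mkord xpredT (fun i => node m i.+1 - node m i)) telescope_sumr//.
by rewrite node_last node_first subr0.
Qed.

Lemma cell_size_le j : cell_size j <= mesh_size m.
Proof. by rewrite /mesh_size (bigmaxD1 j)//= le_max lexx. Qed.

Lemma node_le (i i' : nat) : (i <= i')%N -> (i' <= N)%N -> node m i <= node m i'.
Proof.
elim: i' => [|i' IH]; first by rewrite leqn0 => /eqP ->.
rewrite leq_eqVlt => /predU1P[->//|]; rewrite ltnS => ii' i'N.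
by rewrite (le_trans (IH ii' (ltnW i'N)))// ltW// node_lt.
Qed.

Lemma node_itv (i : nat) : (i <= N)%N -> 0 <= node m i <= 1.
Proof. by move=> iN; rewrite -{1}(node_first m) -(node_last m) !node_le. Qed.

Lemma ncells_gt0 : (0 < N)%N.
Proof.
rewrite lt0n; apply/eqP => N0; have := node_last m.
by rewrite N0 node_first => /esym/eqP; rewrite oner_eq0.
Qed.

Lemma mesh_size_gt0 : 0 < mesh_size m.
Proof. exact: lt_le_trans (cell_size_gt0 (Ordinal ncells_gt0)) (cell_size_le _). Qed.

Lemma mesh_size_le1 : mesh_size m <= 1.
Proof.
apply: bigmax_le => // j _; rewrite /cell_size.
have := node_itv (ltnW (ltn_ord j)); have := node_itv (ltn_ord j); lra.
Qed.

Lemma broken_polyD v w j : (v + w) j = v j + w j.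
Proof. by rewrite ffunE. Qed.

Lemma broken_polyZ a v j : (a *: v) j = a *: v j.
Proof. by rewrite ffunE. Qed.

Lemma broken_polyN v j : (- v) j = - v j.
Proof. by rewrite ffunE. Qed.

Lemma in_VhD k v w : in_Vh k v -> in_Vh k w -> in_Vh k (v + w).
Proof.
move=> hv hw j; rewrite ffunE (leq_trans (size_polyD _ _))//.
by rewrite geq_max hv hw.
Qed.

Lemma in_VhZ k a v : in_Vh k v -> in_Vh k (a *: v).
Proof. by move=> hv j; rewrite ffunE (leq_trans (size_scale_leq _ _)). Qed.

Lemma in_VhB k v w : in_Vh k v -> in_Vh k w -> in_Vh k (v - w).
Proof. by move=> hv hw; rewrite -scaleN1r; apply: in_VhD => //; exact: in_VhZ. Qed.

Lemma in_Vh_deriv k v : in_Vh k v -> in_Vh k (dg_deriv v).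
Proof.
move=> hv j; rewrite ffunE; apply: size_deriv_leq.
exact: leq_trans (hv j) (leqnSn _).
Qed.

Definition dg_dot v w : R := \sum_(j < N) pint (lft j) (rgt j) (v j * w j).

Definition dg_norm v : R := Num.sqrt (dg_dot v v).

Lemma dg_dotC v w : dg_dot v w = dg_dot w v.
Proof. by apply: eq_bigr => j _; rewrite mulrC. Qed.

Lemma dg_dotDl v w phi : dg_dot (v + w) phi = dg_dot v phi + dg_dot w phi.
Proof. by rewrite -big_split; apply: eq_bigr => j _; rewrite ffunE mulrDl pintD. Qed.

Lemma dg_dotZl a v phi : dg_dot (a *: v) phi = a * dg_dot v phi.
Proof. by rewrite mulr_sumr; apply: eq_bigr => j _; rewrite ffunE -scalerAl pintZ. Qed.

Lemma dg_dotNl v phi : dg_dot (- v) phi = - dg_dot v phi.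
Proof. by rewrite -scaleN1r dg_dotZl mulN1r. Qed.

Lemma dg_dotDr v w phi : dg_dot phi (v + w) = dg_dot phi v + dg_dot phi w.
Proof. by rewrite !(dg_dotC phi) dg_dotDl. Qed.

Lemma dg_dotZr a v phi : dg_dot phi (a *: v) = a * dg_dot phi v.
Proof. by rewrite !(dg_dotC phi) dg_dotZl. Qed.

Lemma dg_dotNr v phi : dg_dot phi (- v) = - dg_dot phi v.
Proof. by rewrite !(dg_dotC phi) dg_dotNl. Qed.

Definition dg_dotE := (dg_dotDl, dg_dotDr, dg_dotZl, dg_dotZr, dg_dotNl, dg_dotNr).

Lemma pint_sqr_ge0 j (p : {poly R}) : 0 <= pint (lft j) (rgt j) (p * p).
Proof.
by apply: pint_ge0 => [|x _]; [exact/ltW/cell_lt|rewrite hornerM -expr2 sqr_ge0].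
Qed.

Lemma dg_dot_ge0 v : 0 <= dg_dot v v.
Proof. by apply: sumr_ge0 => j _; exact: pint_sqr_ge0. Qed.

Lemma dg_dot_eq0 v : dg_dot v v = 0 -> v = 0.
Proof.
move/eqP; rewrite psumr_eq0 => [/allP h|j _]; last exact: pint_sqr_ge0.
apply/ffunP => j; rewrite ffunE; apply/eqP; rewrite -sqrf_eq0 expr2; apply/eqP.
have /= /eqP := h j (mem_index_enum j); apply: pint_eq0 => [|x _]; first exact: cell_lt.
by rewrite hornerM -expr2 sqr_ge0.
Qed.

Lemma dg_norm_ge0 v : 0 <= dg_norm v. Proof. exact: sqrtr_ge0. Qed.

Lemma dg_norm_sqr v : dg_norm v ^+ 2 = dg_dot v v.
Proof. by rewrite sqr_sqrtr ?dg_dot_ge0. Qed.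

Lemma dg_cauchy_schwarz v w : `|dg_dot v w| <= dg_norm v * dg_norm w.
Proof.
apply: sqr_le_norm; rewrite ?dg_dot_ge0//; apply: psd_cauchy_schwarz => s t.
have := dg_dot_ge0 (s *: v + t *: w); rewrite !dg_dotE (dg_dotC w v).
by congr (_ <= _); ring.
Qed.

Lemma dg_normD v w : dg_norm (v + w) <= dg_norm v + dg_norm w.
Proof.
rewrite -ler_sqr ?nnegrE ?addr_ge0 ?dg_norm_ge0// dg_norm_sqr !dg_dotE (dg_dotC w v).
have := dg_cauchy_schwarz v w; rewrite ler_norml => /andP[_].
have := dg_norm_sqr v; have := dg_norm_sqr w; nra.
Qed.

Lemma dg_normZ a v : dg_norm (a *: v) = `|a| * dg_norm v.
Proof. by rewrite /dg_norm !dg_dotE mulrA -expr2 sqrtrM ?sqr_ge0// sqrtr_sqr. Qed.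

Lemma dg_normN v : dg_norm (- v) = dg_norm v.
Proof. by rewrite /dg_norm !dg_dotE opprK. Qed.

Lemma dg_norm_le_dual v B : 0 <= B -> dg_dot v v <= B * dg_norm v -> dg_norm v <= B.
Proof.
move=> B0; rewrite -dg_norm_sqr; have := dg_norm_ge0 v.
rewrite le_eqVlt => /predU1P[<-//|v0]; rewrite expr2 ler_pM2r//.
Qed.

Definition jump v j : R := trace_left_plus v j - trace_left_minus v j.

Lemma jumpD v w j : jump (v + w) j = jump v j + jump w j.
Proof.
rewrite /jump /trace_left_plus /trace_left_minus /trace_right !ffunE !hornerD; ring.
Qed.

Lemma jumpZ a v j : jump (a *: v) j = a * jump v j.
Proof.
rewrite /jump /trace_left_plus /trace_left_minus /trace_right !ffunE !hornerZ; ring.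
Qed.

(* The bilinear form [dgH] after evaluation of the integrals. *)
Definition poly_dgH c v phi : R := \sum_(j < N)
  (c * pint (lft j) (rgt j) (v j * (phi j)^`())
   - c * (trace_right v j * trace_right phi j
          - trace_left_minus v j * trace_left_plus phi j)).

Lemma dgH_by_parts c v phi : poly_dgH c v phi
  = - c * (dg_dot (dg_deriv v) phi + \sum_(j < N) jump v j * trace_left_plus phi j).
Proof.
rewrite /dg_dot -big_split mulr_sumr; apply: eq_bigr => j _ /=.
rewrite pint_by_parts ffunE !hornerM /jump /trace_right /trace_left_plus; ring.
Qed.

Lemma sum_ord_pred (F : 'I_N -> R) : \sum_j F (ord_pred j) = \sum_j F j.
Proof. by rewrite [RHS](reindex_inj (can_inj (@ord_predK N))). Qed.

(** Upwinding makes the form skew up to dissipation at the interfaces: by parts the cell integrals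
    cancel, and the terms at right ends regroup with those at left ends after the cyclic shift
    [ord_pred]. *)
Lemma dgH_skew c v phi : poly_dgH c v phi + poly_dgH c phi v
  = - c * \sum_(j < N) jump v j * jump phi j.
Proof.
pose r j := trace_right v j * trace_right phi j.
have r0 : \sum_j - c * (r j - r (ord_pred j)) = 0.
  by rewrite -mulr_sumr sumrB sum_ord_pred subrr mulr0.
rewrite (dgH_by_parts c phi v) /poly_dgH /dg_dot -big_split/= !mulr_sumr -big_split/=.
rewrite -[RHS]addr0 -[X in _ + X]r0 -big_split/=.
apply: eq_bigr => j _; rewrite ffunE (mulrC (v j)) /r /jump /trace_left_minus; ring.
Qed.

End BrokenPolynomials.

(** * Quadrature and nodal interpolation on a single cell *)

Section CellQuadrature.
Variables (R : realType) (k : nat) (xi : 'I_k.+1 -> R).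
Hypothesis hxi : gauss_legendre xi.
Implicit Types (p q : {poly R}) (a b x : R) (F G : 'I_k.+1 -> R) (i : 'I_k.+1).

Definition gauss_node a b i : R := (a + b) / 2 + (b - a) / 2 * xi i.

Definition cell_map a b : {poly R} := (2 / (b - a)) *: ('X - ((a + b) / 2)%:P).

Definition cell_interp a b F : {poly R} := interp xi F \Po cell_map a b.

Lemma size_comp_affine p s x : s != 0 ->
  size (p \Po (s *: ('X - x%:P))) = size p.
Proof. by move=> s0; rewrite size_comp_poly2// size_scale// size_XsubC. Qed.

Lemma cell_map_node a b i : a < b -> (cell_map a b).[gauss_node a b i] = xi i.
Proof.
move=> ab; rewrite /cell_map /gauss_node hornerZ hornerXsubC.
by field; rewrite gt_eqF// subr_gt0.
Qed.

Lemma cell_map_left a b : a < b -> (cell_map a b).[a] = -1.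
Proof.
by move=> ab; rewrite /cell_map hornerZ hornerXsubC; field; rewrite gt_eqF// subr_gt0.
Qed.

Lemma cell_interp_node a b F i : a < b -> (cell_interp a b F).[gauss_node a b i] = F i.
Proof. by move=> ab; rewrite /cell_interp horner_comp cell_map_node// interp_xi. Qed.

Lemma size_cell_interp a b F : a < b -> (size (cell_interp a b F) <= k.+1)%N.
Proof.
move=> ab; rewrite size_comp_affine ?size_interp//.
by rewrite gt_eqF// divr_gt0// subr_gt0.
Qed.

Lemma gauss_node_itv a b i : a < b -> a < gauss_node a b i < b.
Proof.
move=> ab; rewrite /gauss_node; have := gauss_point_itv hxi i => /andP[x1 x2].
apply/andP; split; nra.
Qed.

Lemma cell_quadrature a b p : a < b -> (size p <= k.+1 + k.+1)%N ->
  pint a b p = \sum_i (b - a) / 2 * gauss_weight xi i * p.[gauss_node a b i].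
Proof.
move=> ab sp; rewrite pint_affine (gauss_exact hxi); last first.
  rewrite (_ : (b - a) / 2 *: 'X + ((a + b) / 2)%:P =
    ((b - a) / 2) *: ('X - (- (a + b) / (b - a))%:P)).
    by rewrite size_comp_affine// gt_eqF// divr_gt0// subr_gt0.
  rewrite scalerBr; congr (_ + _); rewrite -mul_polyC -rmorphM -rmorphN.
  by congr _%:P; field; rewrite gt_eqF// subr_gt0.
rewrite mulr_sumr; apply: eq_bigr => i _; rewrite -mulrA.
by rewrite horner_comp !hornerE [_ + (a + b) / 2]addrC.
Qed.

Lemma cell_interpK a b p : a < b -> (size p <= k.+1)%N ->
  cell_interp a b (fun i => p.[gauss_node a b i]) = p.
Proof.
move=> ab sp; set q := cell_interp _ _ _.
have sq : (size (q - p)%R <= k.+1)%N.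
  by rewrite (leq_trans (size_polyD _ _))// geq_max size_polyN sp size_cell_interp.
apply/eqP; rewrite -subr_eq0 -sqrf_eq0; apply/eqP; apply: (pint_eq0 ab).
  by move=> x _; rewrite horner_exp sqr_ge0.
rewrite cell_quadrature//.
  rewrite big1// => i _; rewrite horner_exp hornerD hornerN cell_interp_node//.
  by rewrite subrr expr0n mulr0.
by rewrite (leq_trans (size_polyMleq _ _))// (leq_trans (leq_pred _))// leq_add.
Qed.

Lemma cell_interpD a b F G :
  cell_interp a b (fun i => F i + G i) = cell_interp a b F + cell_interp a b G.
Proof.
rewrite /cell_interp -rmorphD -big_split; congr (_ \Po _).
by apply: eq_bigr => i _; rewrite scalerDl.
Qed.

(** The Riesz representer of evaluation at [a], among polynomials of degree at most [k] with the
    inner product of [L^2(a, b)], given by its values at the Gauss points. It turns the interface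
    term of the form into an element of [V_h]. *)
Definition left_kernel a b : {poly R} := cell_interp a b
  (fun i => (nodal xi i).[-1] / ((b - a) / 2 * gauss_weight xi i)).

Lemma left_kernelP a b q : a < b -> (size q <= k.+1)%N ->
  pint a b (left_kernel a b * q) = q.[a].
Proof.
move=> ab sq; rewrite cell_quadrature//; last first.
  rewrite (leq_trans (size_polyMleq _ _))// (leq_trans (leq_pred _))// leq_add//.
  exact: size_cell_interp.
rewrite -{2}(cell_interpK ab sq) /cell_interp horner_comp cell_map_left//.
rewrite horner_sum; apply: eq_bigr => i _.
rewrite hornerM cell_interp_node// [RHS]hornerZ mulrA mulrCA mulfV ?mulr1.
  by rewrite mulrC.
by rewrite gt_eqF// !mulr_gt0 ?gauss_weight_gt0// subr_gt0.
Qed.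

Lemma sum_gauss_weight : \sum_i gauss_weight xi i = 2.
Proof.
have := @gauss_exact _ _ _ hxi 1%:P; rewrite pintC size_polyC oner_neq0.
under eq_bigr do rewrite hornerC mulr1.
by move=> /(_ isT) <-; ring.
Qed.

End CellQuadrature.

(** * Stability and consistency of the Runge-Kutta step *)

Section DGOperator.
Variables (R : realType) (k : nat) (xi : 'I_k.+1 -> R) (m : mesh R).
Hypothesis hxi : gauss_legendre xi.
Local Notation N := (ncells m).
Local Notation BP := (broken_poly m).
Implicit Types (v w phi psi y z : BP) (j : 'I_N) (i : 'I_k.+1) (d : R).

Local Notation lft j := (node m (nat_of_ord j)).
Local Notation rgt j := (node m (nat_of_ord j).+1).

Lemma gauss_pointE j i : gauss_point xi j i = gauss_node xi (lft j) (rgt j) i.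
Proof. by []. Qed.

Definition grid_interp (F : 'I_N -> 'I_k.+1 -> R) : BP :=
  [ffun j : 'I_N => cell_interp xi (lft j) (rgt j) (F j)].

Lemma grid_interp_Vh F : in_Vh k (grid_interp F).
Proof. by move=> j; rewrite ffunE size_cell_interp// cell_lt. Qed.

Lemma grid_interp_point F j i : (grid_interp F j).[gauss_point xi j i] = F j i.
Proof. by rewrite ffunE cell_interp_node// cell_lt. Qed.

Lemma dg_dot_gauss v w : in_Vh k v -> in_Vh k w ->
  dg_dot v w = \sum_j \sum_i cell_size j / 2 * gauss_weight xi i
    * ((v j).[gauss_point xi j i] * (w j).[gauss_point xi j i]).
Proof.
move=> hv hw; apply: eq_bigr => j _; rewrite (cell_quadrature hxi) ?cell_lt//.
  by apply: eq_bigr => i _; rewrite hornerM.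
rewrite (leq_trans (size_polyMleq _ _))// (leq_trans (leq_pred _))// leq_add//.
Qed.

Lemma dg_norm_gauss_le v w : in_Vh k v -> in_Vh k w ->
  (forall j i, `|(v j).[gauss_point xi j i]| <= `|(w j).[gauss_point xi j i]|) ->
  dg_norm v <= dg_norm w.
Proof.
move=> hv hw h; rewrite ler_wsqrtr// !dg_dot_gauss//.
apply: ler_sum => j _; apply: ler_sum => i _; apply: ler_wpM2l.
  by rewrite mulr_ge0 ?divr_ge0// ltW ?cell_size_gt0// gauss_weight_gt0.
by rewrite -!expr2 -real_normK ?num_real// -[leRHS]real_normK ?num_real//
  lerXn2r ?nnegrE.
Qed.

(** The majorant in the hypothesis is a sum of absolute values, not a polynomial; interpolating
    these at the Gauss points brings it into [V_h] without increasing the norms. *)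
Lemma dg_norm_gauss_leD v w y : in_Vh k v -> in_Vh k w -> in_Vh k y ->
  (forall j i, `|(v j).[gauss_point xi j i]|
    <= `|(w j).[gauss_point xi j i]| + `|(y j).[gauss_point xi j i]|) ->
  dg_norm v <= dg_norm w + dg_norm y.
Proof.
move=> hv hw hy h.
pose a (z : BP) := grid_interp (fun j i => `|(z j).[gauss_point xi j i]|).
have aE z : in_Vh k z -> dg_norm (a z) <= dg_norm z.
  move=> hz; apply: dg_norm_gauss_le => // [|j i]; first exact: grid_interp_Vh.
  by rewrite grid_interp_point normr_id.
apply: le_trans (lerD (aE _ hw) (aE _ hy)); apply: le_trans (dg_normD _ _).
apply: dg_norm_gauss_le => // [|j i]; first by apply: in_VhD; exact: grid_interp_Vh.
rewrite broken_polyD hornerD !grid_interp_point (le_trans (h j i))//.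
exact: ler_norm.
Qed.

Lemma dg_dot_gauss_bound v (B : 'I_N -> R) : in_Vh k v ->
  (forall j i, `|(v j).[gauss_point xi j i]| <= B j) ->
  dg_dot v v <= \sum_j cell_size j * B j ^+ 2.
Proof.
move=> hv hB; rewrite dg_dot_gauss//; apply: ler_sum => j _.
rewrite (_ : cell_size j * B j ^+ 2 =
  \sum_i cell_size j / 2 * gauss_weight xi i * B j ^+ 2); last first.
  by rewrite -mulr_suml -mulr_sumr (sum_gauss_weight hxi) divfK.
apply: ler_sum => i _; apply: ler_wpM2l.
  by rewrite mulr_ge0 ?divr_ge0// ltW ?cell_size_gt0// gauss_weight_gt0.
rewrite -expr2 -real_normK ?num_real// lerXn2r ?nnegrE//.
exact: le_trans (hB j i).
Qed.

(* [d] is [c * dt]: [dg_op (c * dt) v] represents [dt * dgH c v] in [V_h]. *)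
Definition dg_op d v : BP :=
  [ffun j : 'I_N => - d *: ((v j)^`() + jump v j *: left_kernel xi (lft j) (rgt j))].

Lemma dg_op_Vh d v : in_Vh k v -> in_Vh k (dg_op d v).
Proof.
move=> hv j; rewrite ffunE (leq_trans (size_scale_leq _ _))//.
rewrite (leq_trans (size_polyD _ _))// geq_max size_deriv_leq ?(leq_trans (hv j))//=.
by rewrite (leq_trans (size_scale_leq _ _))// size_cell_interp// cell_lt.
Qed.

Lemma dg_opD d v w : dg_op d (v + w) = dg_op d v + dg_op d w.
Proof.
apply/ffunP => j; rewrite !ffunE jumpD derivD -scalerDr; congr (_ *: _).
by rewrite scalerDl addrACA.
Qed.

Lemma dg_opZ d s v : dg_op d (s *: v) = s *: dg_op d v.
Proof.
apply/ffunP => j; rewrite !ffunE jumpZ derivZ -scalerA -scalerDr scalerA.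
by rewrite mulrC -scalerA.
Qed.

Lemma dg_opN d v : dg_op d (- v) = - dg_op d v.
Proof. by rewrite -[in LHS]scaleN1r dg_opZ scaleN1r. Qed.

Lemma dg_op_dot d v phi : in_Vh k phi -> dg_dot (dg_op d v) phi
  = - d * (dg_dot (dg_deriv v) phi + \sum_j jump v j * trace_left_plus phi j).
Proof.
move=> hp; rewrite /dg_dot -big_split mulr_sumr; apply: eq_bigr => j _ /=.
rewrite !ffunE -scalerAl mulrDl pintZ pintD -scalerAl pintZ.
by rewrite (left_kernelP hxi)// cell_lt.
Qed.

Lemma dg_opE c dt v phi : in_Vh k phi ->
  dg_dot (dg_op (c * dt) v) phi = dt * poly_dgH c v phi.
Proof. by move=> hp; rewrite dg_op_dot// dgH_by_parts; ring. Qed.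

Lemma dg_op_skew d v w : in_Vh k v -> in_Vh k w ->
  dg_dot (dg_op d v) w + dg_dot (dg_op d w) v = - d * \sum_j jump v j * jump w j.
Proof.
move=> hv hw; rewrite -[d]mulr1 !dg_opE// !mul1r dgH_skew mulr1//.
Qed.

(** The cubic Taylor polynomial of the exponential of [dg_op d], to which the three stages compose;
    see [rk_step_rk3]. *)
Definition rk3 d v : BP := v + dg_op d v + (1 / 2) *: dg_op d (dg_op d v)
  + (1 / 6) *: dg_op d (dg_op d (dg_op d v)).

Lemma rk3_Vh d v : in_Vh k v -> in_Vh k (rk3 d v).
Proof.
by move=> hv; rewrite /rk3; do ![apply: in_VhD|apply: in_VhZ|apply: dg_op_Vh].
Qed.

Lemma rk3D d v w : rk3 d (v + w) = rk3 d v + rk3 d w.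
Proof.
rewrite /rk3 3!dg_opD 2!scalerDr.
by rewrite (addrACA v) (addrACA (v + dg_op d v)) (addrACA (v + _ + _)).
Qed.

Lemma rk3N d v : rk3 d (- v) = - rk3 d v.
Proof.
rewrite /rk3 (dg_opN d v) (dg_opN d (dg_op d v)) dg_opN 2!scalerN.
by rewrite !opprD.
Qed.

Section Estimates.
Variables (Cd Ct d : R).
Hypotheses (Ct0 : 0 <= Ct) (d0 : 0 <= d).
Hypothesis inv_deriv : forall phi, in_Vh k phi ->
  dg_norm (dg_deriv phi) <= Cd * dg_norm phi.
Hypothesis inv_trace : forall phi j x, in_Vh k phi -> lft j <= x <= rgt j ->
  (phi j).[x] ^+ 2 <= Ct * pint (lft j) (rgt j) (phi j * phi j).
Hypothesis cfl : d * (Cd + 2 * Ct) <= 1.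

Definition jump_norm v : R := Num.sqrt (\sum_j jump v j ^+ 2).

Lemma trace_left_plus_norm phi : in_Vh k phi ->
  \sum_j trace_left_plus phi j ^+ 2 <= Ct * dg_dot phi phi.
Proof.
move=> hp; rewrite mulr_sumr; apply: ler_sum => j _.
by apply: inv_trace => //; rewrite lexx ltW// cell_lt.
Qed.

Lemma trace_left_minus_norm phi : in_Vh k phi ->
  \sum_j trace_left_minus phi j ^+ 2 <= Ct * dg_dot phi phi.
Proof.
move=> hp; rewrite (sum_ord_pred (fun j => trace_right phi j ^+ 2)) mulr_sumr.
apply: ler_sum => j _.
by apply: inv_trace => //; rewrite lexx ltW// cell_lt.
Qed.

Lemma jump_norm_le phi : in_Vh k phi ->
  jump_norm phi <= 2 * Num.sqrt Ct * dg_norm phi.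
Proof.
move=> hp; rewrite -ler_sqr ?nnegrE ?mulr_ge0 ?sqrtr_ge0//.
rewrite sqr_sqrtr; last by apply: sumr_ge0 => j _; exact: sqr_ge0.
rewrite !exprMn sqr_sqrtr// dg_norm_sqr.
have := trace_left_plus_norm hp; have := trace_left_minus_norm hp => h1 h2.
have : \sum_j jump phi j ^+ 2 <= 2 * (\sum_j trace_left_plus phi j ^+ 2
    + \sum_j trace_left_minus phi j ^+ 2).
  rewrite -big_split mulr_sumr; apply: ler_sum => j _ /=; rewrite /jump.
  have := sqr_ge0 (trace_left_plus phi j + trace_left_minus phi j); nra.
lra.
Qed.

Lemma jump_pairing v phi : in_Vh k phi ->
  `|\sum_j jump v j * trace_left_plus phi j|
  <= jump_norm v * (Num.sqrt Ct * dg_norm phi).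
Proof.
move=> hp; apply: le_trans (sum_cauchy_schwarz _ _) _.
rewrite ler_wpM2l ?sqrtr_ge0// -sqrtrM// ler_sqrt ?mulr_ge0 ?dg_dot_ge0//.
exact: trace_left_plus_norm.
Qed.

Lemma dg_op_norm v : in_Vh k v ->
  dg_norm (dg_op d v) <= d * (dg_norm (dg_deriv v) + Num.sqrt Ct * jump_norm v).
Proof.
move=> hv; apply: dg_norm_le_dual.
  by rewrite mulr_ge0// addr_ge0 ?mulr_ge0 ?dg_norm_ge0 ?sqrtr_ge0.
set w := dg_op d v; have hw : in_Vh k w by exact: dg_op_Vh.
rewrite {1}/w dg_op_dot// mulNr -mulrN -mulrA ler_wpM2l//.
rewrite (le_trans (ler_norm _))// normrN (le_trans (ler_normD _ _))// mulrDl lerD//.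
  exact: dg_cauchy_schwarz.
by rewrite (le_trans (jump_pairing v hw))// mulrCA mulrA.
Qed.

(** This is what [cfl] is shaped for: the derivative contributes [Cd], and the jumps contribute the
    root of [Ct] twice with the factor 2 of [jump_norm_le], that is [2 * Ct]. *)
Lemma dg_op_contract v : in_Vh k v -> dg_norm (dg_op d v) <= dg_norm v.
Proof.
move=> hv; apply: le_trans (dg_op_norm hv) _.
have n0 := dg_norm_ge0 v; have s0 := sqrtr_ge0 Ct.
have h1 := inv_deriv hv; have h2 := jump_norm_le hv.
apply: (@le_trans _ _ (d * (Cd + 2 * Ct) * dg_norm v)); last by rewrite ler_piMl.
rewrite -mulrA ler_wpM2l// mulrDl lerD//.
rewrite -{2}(sqr_sqrtr Ct0); apply: le_trans (ler_wpM2l s0 h2) _; lra.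
Qed.

Lemma rk3_stable v : in_Vh k v -> dg_norm (rk3 d v) <= dg_norm v.
Proof.
move=> hv; pose v1 := dg_op d v; pose v2 := dg_op d v1; pose v3 := dg_op d v2.
have h1 : in_Vh k v1 by exact: dg_op_Vh.
have h2 : in_Vh k v2 by exact: dg_op_Vh.
have h3 : in_Vh k v3 by exact: dg_op_Vh.
pose S y z : R := d * \sum_j jump y j * jump z j.
have e y z : in_Vh k y -> in_Vh k z ->
    dg_dot (dg_op d y) z = - S y z - dg_dot y (dg_op d z).
  move=> hy hz; have := dg_op_skew d hy hz.
  by rewrite (dg_dotC (dg_op d z)) mulNr -/(S y z); lra.
(* The energy identity is |rk3 v|^2 - |v|^2 = - |v2|^2 / 12 + |v3|^2 / 36 - Q,
   where Q has coefficient 1 / 12 at S v2 v2 and is not semidefinite. It becomes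
   a sum of squares with 1 / 9, and - |v2|^2 / 12 absorbs the difference. *)
have S0 : 0 <= S v v + S v v1 + S v v2 / 3 + S v1 v1 / 3 + S v1 v2 / 3
    + S v2 v2 / 9.
  rewrite (_ : _ + _ = d * \sum_j
    ((jump v j + jump v1 j / 2 + jump v2 j / 6) ^+ 2
      + (jump v1 j + jump v2 j) ^+ 2 / 12)).
    by rewrite mulr_ge0// sumr_ge0// => j _; rewrite addr_ge0 ?divr_ge0 ?sqr_ge0.
  rewrite /S -!mulrA -!mulrDr !mulr_suml -!big_split/=; congr (_ * _).
  by apply: eq_bigr => j _; field.
have e01 := e v v hv hv; have e12 := e v1 v1 h1 h1; have e23 := e v2 v2 h2 h2.
have e02 := e v1 v h1 hv; have e03 := e v2 v h2 hv; have e13 := e v2 v1 h2 h1.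
rewrite -/v1 -/v2 -/v3 in e01 e12 e23 e02 e03 e13.
have SC y z : S y z = S z y.
  by rewrite /S; congr (_ * _); apply: eq_bigr => j _; rewrite mulrC.
rewrite (SC v1 v) in e02; rewrite (SC v2 v) in e03; rewrite (SC v2 v1) in e13.
rewrite (dg_dotC v2 v) (dg_dotC v2 v1) (dg_dotC v1 v) (dg_dotC v3 v)
  (dg_dotC v3 v1) (dg_dotC v3 v2) in e01 e12 e23 e02 e03 e13.
(* The excess [S v2 v2 / 36] equals [- (v2, v3) / 18], at most [(|v2|^2 + |v3|^2) / 36] by [p23].
   Together with the two squares of the identity this is at most [(|v3|^2 - |v2|^2) / 18], which
   [n23] makes nonpositive. *)
have n23 : dg_dot v3 v3 <= dg_dot v2 v2.
  by rewrite -!dg_norm_sqr lerXn2r ?nnegrE ?dg_norm_ge0 ?dg_op_contract.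
have p23 := dg_dot_ge0 (v2 + v3).
rewrite !dg_dotE (dg_dotC v3 v2) in p23.
rewrite ler_wsqrtr// /rk3 -/v1 -/v2 -/v3 !dg_dotE.
rewrite (dg_dotC v2 v) (dg_dotC v2 v1) (dg_dotC v1 v) (dg_dotC v3 v)
  (dg_dotC v3 v1) (dg_dotC v3 v2).
lra.
Qed.

Lemma dg_op_deriv_norm v : in_Vh k v ->
  dg_norm (dg_op d v + d *: dg_deriv v) <= d * (Num.sqrt Ct * jump_norm v).
Proof.
move=> hv; apply: dg_norm_le_dual; first by rewrite !mulr_ge0 ?sqrtr_ge0.
set w := _ + _; have hw : in_Vh k w.
  by apply: in_VhD; [exact: dg_op_Vh|apply/in_VhZ/in_Vh_deriv].
have -> : dg_dot w w = - (d * \sum_j jump v j * trace_left_plus w j).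
  by rewrite {1}/w dg_dotDl dg_op_dot// dg_dotZl; ring.
rewrite (le_trans (ler_norm _))// normrN normrM (ger0_norm d0) -mulrA ler_wpM2l//.
by rewrite (le_trans (jump_pairing v hw))// mulrCA mulrA.
Qed.

Section Truncation.
Variables (h sg : R) (tau : 'I_N -> R).
Hypotheses (h0 : 0 < h) (cell_h : forall j, cell_size j <= h) (dh : d <= h).
Hypotheses (sg0 : 0 <= sg) (tau_sg : \sum_j tau j ^+ 2 <= sg ^+ 2).

Lemma weighted_norm_le (f : 'I_N -> R) (M : R) : 0 <= M ->
  (forall j, `|f j| <= M * tau j) -> Num.sqrt (\sum_j f j ^+ 2) <= M * sg.
Proof.
move=> M0 hf; rewrite -(ger0_norm (mulr_ge0 M0 sg0)) -sqrtr_sqr.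
rewrite ler_wsqrtr// exprMn; apply: le_trans (ler_wpM2l (sqr_ge0 M) tau_sg).
rewrite mulr_sumr; apply: ler_sum => j _.
rewrite -exprMn -real_normK ?num_real// lerXn2r ?nnegrE//.
exact: le_trans (hf j).
Qed.

Lemma gauss_norm_le v (M : R) : in_Vh k v -> 0 <= M ->
  (forall j i, `|(v j).[gauss_point xi j i]| <= M * tau j) ->
  dg_norm v <= M * sg * Num.sqrt h.
Proof.
move=> hv M0 hM.
rewrite -(ger0_norm (mulr_ge0 M0 sg0)) -sqrtr_sqr -sqrtrM ?sqr_ge0//.
rewrite ler_wsqrtr// (le_trans (dg_dot_gauss_bound hv hM))//.
rewrite mulrC exprMn; apply: (@le_trans _ _ (h * (M ^+ 2 * \sum_j tau j ^+ 2))).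
  rewrite !mulr_sumr; apply: ler_sum => j _.
  by rewrite exprMn ler_wpM2r// mulr_ge0 ?sqr_ge0.
by rewrite ler_wpM2l ?(ltW h0)// ler_wpM2l ?sqr_ge0.
Qed.

(* [v] is the interpolant of the exact solution, [ut] that of its translate;
   [tau j] measures the local deviation of the solution from a linear
   function, which [rk3] transports exactly. *)
Lemma rk3_truncation (A Ci : R) v (ut : 'I_N -> 'I_k.+1 -> R) :
  in_Vh k v -> 0 <= A -> 0 <= Ci -> Ct = Ci ^+ 2 / h ->
  (forall j, `|jump v j| <= A * h * tau j) ->
  (forall j, `|jump (dg_deriv v) j| <= A * tau j) ->
  (forall j i, `|(dg_deriv (dg_deriv v) j).[gauss_point xi j i]| <= A / h * tau j) ->
  (forall j i, `|(v j).[gauss_point xi j i] - d * (v j)^`().[gauss_point xi j i]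
     - ut j i| <= A * h * tau j) ->
  dg_norm (rk3 d v - grid_interp ut) <= A * (2 + 3 * Ci) * sg * (h * Num.sqrt h).
Proof.
move=> hv A0 Ci0 CtE hj hjx hxx hut; set q := Num.sqrt h.
have q0 : 0 < q by rewrite sqrtr_gt0.
have h0' := ltW h0; have q0' := ltW q0.
have hq : h = q ^+ 2 by rewrite sqr_sqrtr// ltW.
have sCt : Num.sqrt Ct = Ci / q.
  by rewrite CtE sqrtrM ?sqr_ge0// sqrtr_sqr ger0_norm// sqrtrV ?(ltW h0).
have hq0 : 0 <= h * q by rewrite mulr_ge0// ltW.
set E := A * sg * (h * q); have E0 : 0 <= E by rewrite !mulr_ge0.
have hvx : in_Vh k (dg_deriv v) by exact: in_Vh_deriv.
pose r1 := dg_op d v + d *: dg_deriv v.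
have hr1 : in_Vh k r1 by apply: in_VhD; [exact: dg_op_Vh|exact: in_VhZ].
have Jv : jump_norm v <= A * h * sg.
  by apply: weighted_norm_le => //; rewrite mulr_ge0// ltW.
have Jvx : jump_norm (dg_deriv v) <= A * sg by apply: weighted_norm_le.
have nvxx : dg_norm (dg_deriv (dg_deriv v)) <= A / h * sg * q.
  by apply: gauss_norm_le => //; [exact: in_Vh_deriv|rewrite divr_ge0// ltW].
have Jq y M : 0 <= M -> jump_norm y <= M ->
    Num.sqrt Ct * jump_norm y <= Ci * (M / q).
  move=> M0 hy; rewrite sCt mulrAC -mulrA ler_wpM2l// ler_wpM2r// invr_ge0 ltW//.
have nr1 : dg_norm r1 <= Ci * E.
  apply: le_trans (dg_op_deriv_norm hv) _.
  have := Jq v (A * h * sg) ltac:(by rewrite !mulr_ge0) Jv => J1.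
  apply: le_trans (ler_wpM2l d0 J1) _.
  rewrite (_ : Ci * E = h * (Ci * (A * h * sg / q))).
    by rewrite ler_wpM2r// !mulr_ge0// invr_ge0.
  by rewrite /E hq; field; rewrite gt_eqF.
(* In the square of [dg_op], the inner application is replaced by [- d * v_x] up to [r1]; the outer
   one then acts on [v_x], whose jumps are [O(tau)] and whose derivative is [O(tau / h)]. *)
have n2x : d * dg_norm (dg_op d (dg_deriv v)) <= (1 + Ci) * E.
  have J2 := Jq (dg_deriv v) (A * sg) ltac:(by rewrite !mulr_ge0) Jvx.
  have J3 := le_trans (dg_op_norm hvx) (ler_wpM2l d0 (lerD nvxx J2)).
  have s0 : 0 <= A / h * sg * q + Ci * (A * sg / q).
    by rewrite addr_ge0 ?mulr_ge0 ?invr_ge0.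
  have J4 := le_trans J3 (ler_wpM2r s0 dh).
  apply: le_trans (ler_wpM2l d0 J4) _; apply: le_trans (ler_wpM2r _ dh) _.
    by rewrite mulr_ge0// ltW.
  by rewrite le_eqVlt; apply/orP; left; apply/eqP; rewrite /E hq; field; rewrite gt_eqF.
have L1E : dg_op d v = r1 - d *: dg_deriv v by rewrite /r1 addrK.
have n2 : dg_norm (dg_op d (dg_op d v)) <= (1 + 2 * Ci) * E.
  rewrite L1E dg_opD dg_opN dg_opZ; apply: le_trans (dg_normD _ _) _.
  rewrite dg_normN dg_normZ (ger0_norm d0).
  have := le_trans (dg_op_contract hr1) nr1; lra.
have n3 : dg_norm (dg_op d (dg_op d (dg_op d v))) <= (1 + 2 * Ci) * E.
  by apply: le_trans n2; apply: dg_op_contract; do 2 apply: dg_op_Vh.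
have n0 : dg_norm (v - d *: dg_deriv v - grid_interp ut) <= E.
  rewrite /E (_ : A * sg * (h * q) = A * h * sg * q); last ring.
  apply: gauss_norm_le; last 1 first.
  - move=> j i; rewrite !(broken_polyD, broken_polyN, broken_polyZ) ffunE.
    by rewrite !(hornerD, hornerN, hornerZ) grid_interp_point; exact: hut.
  - by do ![apply: in_VhB|apply: in_VhZ]; rewrite //; exact: grid_interp_Vh.
  - by rewrite mulr_ge0// ltW.
(* Only the first-order part is matched with the translate; the quadratic and cubic terms are small
   by themselves. In units of [E] the bounds add up to [1 + Ci + (1/2 + 1/6) * (1 + 2 * Ci) <= 2 + 3
   * Ci]. *)
have -> : rk3 d v - grid_interp ut = (v - d *: dg_deriv v - grid_interp ut) + r1
    + (1 / 2) *: dg_op d (dg_op d v) + (1 / 6) *: dg_op d (dg_op d (dg_op d v)).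
  rewrite /rk3 {1}L1E; set x2 := _ *: dg_op d _; set x3 := _ *: dg_op d _.
  set w := d *: _; set g := grid_interp ut.
  rewrite [in RHS](addrAC (v - w)) [in RHS](addrAC (v - w + r1)).
  by rewrite [in RHS](addrAC (v - w + r1 + x2)) [in RHS](addrAC v) -[in RHS](addrA v).
apply: le_trans (dg_normD _ _) _; rewrite dg_normZ ger0_norm//.
have h3 := dg_normD (v - d *: dg_deriv v - grid_interp ut + r1)
  ((1 / 2) *: dg_op d (dg_op d v)).
have h4 := dg_normD (v - d *: dg_deriv v - grid_interp ut) r1.
rewrite dg_normZ ger0_norm// in h3.
rewrite (_ : A * _ * sg * (h * q) = (2 + 3 * Ci) * E); last by rewrite /E; ring.
have CE : 0 <= Ci * E by rewrite mulr_ge0.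
by nra.
Qed.

End Truncation.
End Estimates.
End DGOperator.
(** * Lebesgue integrals of piecewise functions *)

Lemma integrable_setU d (T : measurableType d) (R : realType)
  (nu : measure T R) (A B : set T) (f : T -> \bar R) :
  measurable A -> measurable B -> [disjoint A & B] ->
  nu.-integrable A f -> nu.-integrable B f -> nu.-integrable (A `|` B) f.
Proof.
move=> mA mB AB iA iB.
have [mfA fA] := integrableP _ _ _ iA; have [mfB fB] := integrableP _ _ _ iB.
apply/integrableP; split; first exact: (measurable_funU _ mA mB).2 (conj mfA mfB).
have maA := measurable_int _ (integrable_abse iA).
have maB := measurable_int _ (integrable_abse iB).
rewrite ge0_integral_setU//; last exact: (measurable_funU _ mA mB).2 (conj maA maB).
exact: lte_add_pinfty.
Qed.

Section LebesgueLink.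
Variable R : realType.
Local Notation mu := (@lebesgue_measure R).
Implicit Types (f F : R -> R) (a b x B : R) (p : {poly R}).

Lemma integrable_continuous_itv f a b : continuous f ->
  mu.-integrable `]a, b[%classic (EFin \o f).
Proof.
move=> cf; have i : mu.-integrable `[a, b]%classic (EFin \o f).
  apply: continuous_compact_integrable; first exact: segment_compact.
  exact: continuous_subspaceT.
by apply: integrableS i => //; apply: subset_itv; rewrite bnd_simp.
Qed.

Lemma integrable_set1 (r : R) f : mu.-integrable [set r] (EFin \o f).
Proof.
apply/integrableP; split; first exact: measurable_fun_set1.
by rewrite integral_set1.
Qed.

Lemma Rintegral_poly a b p : a < b ->
  \int[mu]_(x in `]a, b[) p.[x] = pint a b p.
Proof.
move=> ab; have ip := @integrable_continuous_itv (horner p) a b (@continuous_horner R p).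
rewrite Rintegral_itv_bndo_bndc// Rintegral_itv_obnd_cbnd; last first.
  have i : mu.-integrable `[a, b]%classic (EFin \o horner p).
    apply: continuous_compact_integrable; first exact: segment_compact.
    exact/continuous_subspaceT/continuous_horner.
  by apply: integrableS i => //; apply: subset_itv; rewrite bnd_simp.
rewrite /Rintegral (continuous_FTC2 (F := horner (pprim p)) ab)//=.
- exact/continuous_subspaceT/continuous_horner.
- split.
  + by move=> x _; have [] := is_derive_poly (pprim p) x.
  + exact/cvg_at_right_filter/continuous_horner.
  + exact/cvg_at_left_filter/continuous_horner.
- by move=> x _; rewrite derive1E; have [_ ->] := is_derive_poly (pprim p) x; rewrite pprimK.
Qed.

Variable m : mesh R.
Local Notation N := (ncells m).
Local Notation BP := (broken_poly m).
Local Notation lft j := (node m (nat_of_ord j)).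
Local Notation rgt j := (node m (nat_of_ord j).+1).

(** [F] is prescribed only inside the cells. The half-open cells []lft j, rgt j]] tile []0, 1]], and
    the interfaces are single points, harmless both for integrability and for the value. *)
Lemma piecewise_integral F (f : 'I_N -> R -> R) :
  (forall j, continuous (f j)) -> (forall j x, lft j < x < rgt j -> F x = f j x) ->
  mu.-integrable `]0, 1[%classic (EFin \o F) /\
  \int[mu]_(x in `]0, 1[) F x = \sum_(j < N) \int[mu]_(x in `]lft j, rgt j[) f j x.
Proof.
move=> cf Ff.
have piece j : mu.-integrable `]lft j, rgt j]%classic (EFin \o F) /\
    \int[mu]_(x in `]lft j, rgt j]) F x = \int[mu]_(x in `]lft j, rgt j[) f j x.
  have Fj : {in `]lft j, rgt j[%classic, f j =1 F}.
    by move=> x; rewrite inE/= in_itv/= => /Ff.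
  have i1 : mu.-integrable `]lft j, rgt j[%classic (EFin \o F).
    have i0 := @integrable_continuous_itv (f j) (lft j) (rgt j) (cf j).
    by apply: eq_integrable i0 => // x xj /=; rewrite Fj.
  split; last by rewrite -Rintegral_itv_bndo_bndc//; apply: eq_Rintegral => x /Fj ->.
  rewrite -(setUitv1 true) ?bnd_simp ?cell_lt//.
  apply: (integrable_setU _ _ _ i1 (integrable_set1 _ _)) => //.
    by apply/disj_setPS => x [] /=; rewrite in_itv/= => /andP[_ +] xr; rewrite xr ltxx.
(* The default 0 is never reached; indexing by [nat] lets the induction run over the nodes. *)
pose g (i : nat) : R := if insub i is Some j then \int[mu]_(x in `]lft j, rgt j[) f j x else 0.
have gE (j : 'I_N) : g j = \int[mu]_(x in `]lft j, rgt j[) f j x by rewrite /g valK.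
have H n : (n <= N)%N -> mu.-integrable `]0, node m n]%classic (EFin \o F) /\
    \int[mu]_(x in `]0, node m n]) F x = \sum_(i < n) g i.
  elim: n => [_|n IH nN].
    rewrite node_first set_itv_ge ?bnd_simp ?ltxx// Rintegral_set0 big_ord0.
    by split => //; exact: integrable_set0.
  have [i1 e1] := IH (ltnW nN); have [i2 e2] := piece (Ordinal nN).
  have d : [disjoint `]0, node m n]%classic & `]node m n, node m n.+1]%classic].
    apply/disj_setPS => x [] /=; rewrite !in_itv/= => /andP[_ h1] /andP[h2 _].
    by move: (lt_le_trans h2 h1); rewrite ltxx.
  have e : `]0, node m n.+1]%classic =
      `]0, node m n]%classic `|` `]node m n, node m n.+1]%classic.
    apply: itv_bndbnd_setU; rewrite bnd_simp ?(ltW (node_lt nN))//.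
    by have /andP[] := node_itv (ltnW nN).
  rewrite e; have i12 : mu.-integrable (`]0, node m n]%classic `|`
      `]node m n, node m n.+1]%classic) (EFin \o F).
    by apply: (integrable_setU _ _ _ i1 i2).
  split; first exact: i12.
  rewrite (Rintegral_setU _ _ i12 d)//.
  by rewrite e1 big_ord_recr/= e2 -gE.
have [i e] := H N (leqnn _); rewrite node_last in i e.
have i' : mu.-integrable `]0, 1[%classic (EFin \o F).
  by apply: integrableS i => //; apply: subset_itv; rewrite bnd_simp.
by split => //; rewrite Rintegral_itv_bndo_bndc// e; apply: eq_bigr => j _.
Qed.

Lemma piecewise_integral_poly F (p : BP) :
  (forall j x, lft j < x < rgt j -> F x = (p j).[x]) ->
  \int[mu]_(x in `]0, 1[) F x = \sum_(j < N) pint (lft j) (rgt j) (p j).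
Proof.
move=> Fp; have [_ ->] := piecewise_integral (fun j => @continuous_horner _ (p j)) Fp.
by apply: eq_bigr => j _; rewrite Rintegral_poly// cell_lt.
Qed.

Lemma piecewise_integral_le F (f : 'I_N -> R -> R) (p : BP) :
  (forall j, continuous (f j)) -> (forall j x, lft j < x < rgt j -> F x = f j x) ->
  (forall j x, lft j < x < rgt j -> f j x <= (p j).[x]) ->
  \int[mu]_(x in `]0, 1[) F x <= \sum_(j < N) pint (lft j) (rgt j) (p j).
Proof.
move=> cf Ff fp; have [_ ->] := piecewise_integral cf Ff.
apply: ler_sum => j _; rewrite -Rintegral_poly ?cell_lt//; apply: le_Rintegral => //.
- exact: integrable_continuous_itv.
- exact/integrable_continuous_itv/continuous_horner.
- by move=> x /=; rewrite in_itv/=; exact: fp.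
Qed.

Lemma dg_funE (v : BP) j x : lft j < x < rgt j -> dg_fun v x = (v j).[x].
Proof.
move=> xj; rewrite /dg_fun (bigD1 j)//= in_itv/= xj big1 ?addr0// => i ij.
rewrite in_itv/=; case: ifP => // xi; exfalso.
move: ij; rewrite neq_ltn => /orP[] ij.
  have := node_le ij (ltnW (ltn_ord j)); lra.
by have := node_le ij (ltnW (ltn_ord i)); lra.
Qed.

Lemma L2_dot_dg (v w : BP) : L2_dot (dg_fun v) (dg_fun w) = dg_dot v w.
Proof.
rewrite /L2_dot (piecewise_integral_poly (p := [ffun j => v j * w j])).
  by apply: eq_bigr => j _; rewrite ffunE.
by move=> j x xj; rewrite ffunE hornerM !(dg_funE _ xj).
Qed.

Lemma L2_norm_dg (v : BP) : L2_norm (dg_fun v) = dg_norm v.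
Proof. by rewrite /L2_norm L2_dot_dg. Qed.

Lemma L2_dot_eq_dg F (v w : BP) : (forall j x, lft j < x < rgt j -> F x = (v j).[x]) ->
  L2_dot F (dg_fun w) = dg_dot v w.
Proof.
move=> Fv; rewrite -L2_dot_dg /L2_dot.
rewrite (piecewise_integral_poly (p := [ffun j => v j * w j])); last first.
  by move=> j x xj; rewrite ffunE hornerM (dg_funE _ xj) (Fv _ _ xj).
by rewrite -[RHS]/(L2_dot _ _) L2_dot_dg; apply: eq_bigr => j _; rewrite ffunE.
Qed.

Lemma dgHE c (v phi : BP) : dgH c v phi = poly_dgH c v phi.
Proof.
apply: eq_bigr => j _; rewrite /dgH_cell; congr (_ - _).
have := @Rintegral_poly _ _ (c *: (v j * (phi j)^`())) (cell_lt j).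
rewrite pintZ => <-; apply: eq_Rintegral => x _.
by rewrite hornerZ hornerM mulrA.
Qed.

(** Pointwise domination of the integrand by [2 * (w - v)^2 + 2 * B^2] replaces the triangle
    inequality in [L^2], and the majorant is piecewise polynomial. *)
Lemma dg_norm_L2_error (u : R -> R) (v w : BP) B : continuous u -> 0 <= B ->
  (forall j x, lft j < x < rgt j -> `|(v j).[x] - u x| <= B) ->
  L2_norm (fun x => dg_fun w x - u x) <= 2 * (dg_norm (w - v) + B).
Proof.
move=> cu B0 hB; have n0 := dg_norm_ge0 (w - v).
rewrite -[leRHS]ger0_norm -?sqrtr_sqr; last by rewrite mulr_ge0// addr_ge0.
rewrite ler_wsqrtr// /L2_dot.
apply: le_trans (piecewise_integral_le
  (f := fun j x => ((w j).[x] - u x) * ((w j).[x] - u x))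
  (p := [ffun j => 2 *: ((w - v) j * (w - v) j) + (2 * B ^+ 2)%:P]) _ _ _) _.
- move=> j x; have cw : {for x, continuous (fun y => (w j).[y] - u y)}.
    by apply: continuousB; [exact: continuous_horner|exact: cu].
  exact: (cvgM cw cw).
- by move=> j x xj; rewrite (dg_funE _ xj).
- move=> j x xj; rewrite ffunE hornerD hornerC hornerZ hornerM.
  rewrite broken_polyD broken_polyN hornerD hornerN.
  have := hB j x xj; rewrite ler_norml => /andP[h1 h2].
  have := sqr_ge0 ((w j).[x] - (v j).[x] - ((v j).[x] - u x)).
  have : ((v j).[x] - u x) ^+ 2 <= B ^+ 2 by nra.
  nra.
under eq_bigr => j _ do rewrite ffunE pintD pintZ pintC.
rewrite big_split/= -mulr_sumr -mulr_sumr.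
rewrite [X in _ + _ * X](_ : _ = 1); last exact: sum_cell_size.
rewrite -[X in 2 * X + _]/(dg_dot (w - v) (w - v)) -dg_norm_sqr; nra.
Qed.

(** With [e = w - v], [|e|^2] is the integral of [(u - v) * e] because [e] is a test function;
    Young's inequality, applied pointwise, bounds it by [B^2 / 2 + |e|^2 / 2]. *)
Lemma L2_projection_error k (u : R -> R) (v w : BP) B : continuous u -> 0 <= B ->
  in_Vh k v -> L2_projection k u w ->
  (forall j x, lft j < x < rgt j -> `|(v j).[x] - u x| <= B) ->
  dg_norm (w - v) <= B.
Proof.
move=> cu B0 hv [hw proj] hB; set e := w - v; have he : in_Vh k e by exact: in_VhB.
rewrite -(ger0_norm B0) -sqrtr_sqr ler_wsqrtr//.
suff : dg_dot w e <= dg_dot v e + B ^+ 2 / 2 + dg_dot e e / 2.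
  have : dg_dot e e = dg_dot w e - dg_dot v e by rewrite {1}/e dg_dotDl dg_dotNl.
  lra.
clearbody e; have := proj e he; rewrite L2_dot_dg => ->; rewrite /L2_dot.
apply: le_trans (piecewise_integral_le (f := fun j x => u x * (e j).[x])
  (p := [ffun j => v j * e j + (B ^+ 2 / 2)%:P + (1 / 2) *: (e j * e j)]) _ _ _) _.
- by move=> j x; exact: (cvgM (cu x) (@continuous_horner _ (e j) x)).
- by move=> j x xj; rewrite (dg_funE _ xj).
- move=> j x xj; rewrite ffunE !hornerD hornerC hornerZ !hornerM.
  have := hB j x xj; rewrite ler_norml => /andP[h1 h2].
  have := sqr_ge0 ((v j).[x] - u x + (e j).[x]).
  have : ((v j).[x] - u x) ^+ 2 <= B ^+ 2 by nra.
  nra.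
under eq_bigr => j _ do rewrite ffunE !pintD pintZ pintC.
rewrite 2!big_split/= -2!mulr_sumr.
rewrite [X in _ + _ * X + _](_ : _ = 1); last exact: sum_cell_size.
rewrite -/(dg_dot v e) -/(dg_dot e e); lra.
Qed.

End LebesgueLink.
(** * Inverse inequalities and interpolation *)

Section InverseInequalities.
Variables (R : realType) (m : mesh R) (k : nat) (Cinv : R).
Hypothesis hinv : inverse_inequalities m k Cinv.
Local Notation N := (ncells m).
Local Notation BP := (broken_poly m).
Local Notation lft j := (node m (nat_of_ord j)).
Local Notation rgt j := (node m (nat_of_ord j).+1).
Local Notation h := (mesh_size m).
Implicit Types (phi : BP) (j : 'I_N) (p : {poly R}) (x : R).

(** The inverse inequality is global; testing it on a function supported in one cell localises it,
    and continuity carries the bound to the ends of the cell. *)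
Lemma inverse_trace_poly j p x : (size p <= k.+1)%N -> lft j <= x <= rgt j ->
  `|p.[x]| <= Cinv / Num.sqrt h * Num.sqrt (pint (lft j) (rgt j) (p * p)).
Proof.
move=> sp hx; pose phi : BP := [ffun i => if i == j then p else 0].
have hp : in_Vh k phi.
  by move=> i; rewrite ffunE; case: ifP => // _; rewrite size_poly0.
have [_] := hinv hp; rewrite L2_norm_dg /dg_norm.
have -> : dg_dot phi phi = pint (lft j) (rgt j) (p * p).
  rewrite /dg_dot (bigD1 j)//= ffunE eqxx big1 ?addr0// => i ij.
  by rewrite ffunE (negbTE ij) mul0r pint0.
have /andP[l0 l1] := node_itv (ltnW (ltn_ord j)).
have /andP[r0 r1] := node_itv (ltn_ord j).
move=> hL; apply: (Linfty_le_closure hL l0 r1 (cell_lt j)) => //.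
  by move=> y hy; rewrite (dg_funE _ hy) ffunE eqxx.
exact: continuous_horner.
Qed.

Lemma inverse_trace phi j x : in_Vh k phi -> lft j <= x <= rgt j ->
  (phi j).[x] ^+ 2 <= Cinv ^+ 2 / h * pint (lft j) (rgt j) (phi j * phi j).
Proof.
move=> hp hx; have := inverse_trace_poly (hp j) hx; have h0 := mesh_size_gt0 m.
rewrite -(@ler_pXn2r _ 2) ?nnegrE ?(le_trans (normr_ge0 _) (inverse_trace_poly (hp j) hx))//.
rewrite real_normK ?num_real// => /le_trans; apply; rewrite !exprMn exprVn.
by rewrite !sqr_sqrtr ?(ltW h0) ?pint_sqr_ge0.
Qed.

Lemma inverse_deriv phi : in_Vh k phi ->
  dg_norm (dg_deriv phi) <= Cinv / h * dg_norm phi.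
Proof. by move=> /hinv[+ _]; rewrite !L2_norm_dg. Qed.

(** This is [inverse_trace] for the constant function 1, whose squared norm on the cell is the cell
    size. *)
Lemma quasi_uniform j : h <= Cinv ^+ 2 * cell_size j.
Proof.
have h0 := mesh_size_gt0 m; pose phi : BP := [ffun=> 1%:P].
have hp : in_Vh k phi by move=> i; rewrite ffunE size_polyC oner_neq0.
have lj : lft j <= lft j <= rgt j by rewrite lexx ltW// cell_lt.
have := inverse_trace hp lj.
rewrite ffunE -polyCM mulr1 pintC hornerC expr1n mul1r mulrAC ler_pdivlMr// mul1r.
by [].
Qed.

Lemma inverse_constant_gt0 : 0 < Cinv.
Proof.
have j := Ordinal (ncells_gt0 m).
have lj : lft j <= lft j <= rgt j by rewrite lexx ltW// cell_lt.
have := @inverse_trace_poly j 1%:P _ _ lj; rewrite size_polyC oner_neq0 => /(_ isT).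
rewrite hornerC normr1; apply: contraPT; rewrite -leNgt => C0; apply/negP.
rewrite -ltNge (le_lt_trans _ ltr01)// mulr_le0_ge0 ?sqrtr_ge0//.
by rewrite mulr_le0_ge0// invr_ge0 sqrtr_ge0.
Qed.

End InverseInequalities.

Section Interpolation.
Variables (R : realType) (k : nat) (xi : 'I_k.+1 -> R).
Hypothesis hxi : gauss_legendre xi.
Implicit Types (p : {poly R}) (a b x T M : R) (F : 'I_k.+1 -> R) (i : 'I_k.+1).

Definition coef_norm p : R := \sum_(i < size p) `|p`_i|.

Lemma coef_norm_ge0 p : 0 <= coef_norm p.
Proof. exact: sumr_ge0. Qed.

Lemma horner_coef_norm p x : -1 <= x <= 1 -> `|p.[x]| <= coef_norm p.
Proof.
move=> hx; rewrite horner_coef (le_trans (ler_norm_sum _ _ _))//.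
apply: ler_sum => i _; rewrite normrM normrX ler_piMr// exprn_ile1//.
by rewrite ler_norml.
Qed.

(** A crude Lebesgue constant on the reference cell, for the interpolant and its first two
    derivatives at once. It depends on [xi] alone, hence not on the mesh. *)
Definition interp_const : R := \sum_i
  (coef_norm (nodal xi i) + coef_norm (nodal xi i)^`() + coef_norm (nodal xi i)^`()^`()).

Lemma interp_const_ge0 : 0 <= interp_const.
Proof. by apply: sumr_ge0 => i _; rewrite !addr_ge0 ?coef_norm_ge0. Qed.

Lemma interp_bound F M x : -1 <= x <= 1 -> (forall i, `|F i| <= M) ->
  [/\ `|(interp xi F).[x]| <= M * interp_const,
      `|(interp xi F)^`().[x]| <= M * interp_const &
      `|(interp xi F)^`()^`().[x]| <= M * interp_const].
Proof.
move=> hx hF; have M0 : 0 <= M by exact: le_trans (hF ord0).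
have gen (q : 'I_k.+1 -> {poly R}) :
    (forall i, coef_norm (q i) <= coef_norm (nodal xi i)
       + coef_norm (nodal xi i)^`() + coef_norm (nodal xi i)^`()^`()) ->
    `|\sum_i F i * (q i).[x]| <= M * interp_const.
  move=> hq; rewrite (le_trans (ler_norm_sum _ _ _))// mulr_sumr.
  apply: ler_sum => i _; rewrite normrM ler_pM//.
  exact: le_trans (horner_coef_norm _ hx) (hq i).
have g0 i := coef_norm_ge0 (nodal xi i).
have g1 i := coef_norm_ge0 (nodal xi i)^`().
have g2 i := coef_norm_ge0 (nodal xi i)^`()^`().
have dsum (G : 'I_k.+1 -> {poly R}) : (\sum_i G i)^`() = \sum_i (G i)^`().
  by apply: (big_morph (@deriv R)); [exact: derivD|rewrite -polyC0 derivC].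
rewrite /interp; split.
- rewrite horner_sum; under eq_bigr do rewrite hornerZ.
  by apply: gen => i; have := g1 i; have := g2 i; lra.
- rewrite dsum horner_sum; under eq_bigr do rewrite derivZ hornerZ.
  by apply: gen => i; have := g0 i; have := g2 i; lra.
- rewrite 2!dsum horner_sum; under eq_bigr do rewrite 2!derivZ hornerZ.
  by apply: gen => i; have := g0 i; have := g1 i; lra.
Qed.

Lemma deriv_comp_cell_map a b p :
  (p \Po cell_map a b)^`() = (2 / (b - a)) *: (p^`() \Po cell_map a b).
Proof.
rewrite deriv_comp /cell_map derivZ derivXsubC alg_polyC.
by rewrite mulrC mul_polyC.
Qed.

Lemma cell_map_itv a b x : a < b -> a <= x <= b -> -1 <= (cell_map a b).[x] <= 1.
Proof.
move=> ab hx; have ba : 0 < b - a by rewrite subr_gt0.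
rewrite /cell_map hornerZ hornerXsubC mulrAC ler_pdivlMr// ler_pdivrMr//; lra.
Qed.

Lemma cell_interp_bound a b F M x : a < b -> a <= x <= b -> (forall i, `|F i| <= M) ->
  [/\ `|(cell_interp xi a b F).[x]| <= M * interp_const,
      `|(cell_interp xi a b F)^`().[x]| <= 2 / (b - a) * (M * interp_const) &
      `|(cell_interp xi a b F)^`()^`().[x]|
         <= (2 / (b - a)) ^+ 2 * (M * interp_const)].
Proof.
move=> ab hx hF; have s0 : 0 <= 2 / (b - a) by rewrite divr_ge0// subr_ge0 ltW.
have [h1 h2 h3] := interp_bound (cell_map_itv ab hx) hF; rewrite /cell_interp; split.
- by rewrite horner_comp.
- by rewrite deriv_comp_cell_map hornerZ horner_comp normrM (ger0_norm s0) ler_wpM2l.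
- rewrite deriv_comp_cell_map derivZ deriv_comp_cell_map scalerA hornerZ horner_comp.
  by rewrite normrM ger0_norm -?expr2 ?ler_wpM2l ?sqr_ge0.
Qed.

Lemma gauss_node_shift a b T i : gauss_node xi (a + T) (b + T) i = gauss_node xi a b i + T.
Proof. by rewrite /gauss_node; field. Qed.

Lemma cell_map_shift a b T x :
  (cell_map (a + T) (b + T)).[x + T] = (cell_map a b).[x].
Proof.
rewrite /cell_map !hornerZ !hornerXsubC.
have -> : b + T - (a + T) = b - a by ring.
by congr (_ * _); field.
Qed.

Lemma cell_interp_shift a b T F x :
  (cell_interp xi (a + T) (b + T) F).[x + T] = (cell_interp xi a b F).[x] /\
  (cell_interp xi (a + T) (b + T) F)^`().[x + T] = (cell_interp xi a b F)^`().[x].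
Proof.
rewrite /cell_interp !deriv_comp_cell_map !hornerZ !horner_comp cell_map_shift.
by have -> : b + T - (a + T) = b - a by ring.
Qed.

Hypothesis k1 : (1 <= k)%N.

(** As [k >= 1], interpolation reproduces the linear model, so only the deviation from it is
    interpolated; each derivative costs a factor [2 / (b - a)]. *)
Lemma interp_near_linear (u : R -> R) a b z (s M : R) x : a < b -> a <= x <= b ->
  (forall y, a <= y <= b -> `|u y - (u z + s * (y - z))| <= M) ->
  let v := cell_interp xi a b (fun i => u (gauss_node xi a b i)) in
  [/\ `|v.[x] - (u z + s * (x - z))| <= M * interp_const,
      `|v^`().[x] - s| <= 2 / (b - a) * (M * interp_const) &
      `|v^`()^`().[x]| <= (2 / (b - a)) ^+ 2 * (M * interp_const)].
Proof.
move=> ab hx hM v; pose l : {poly R} := (u z - s * z)%:P + s *: 'X.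
have lE y : l.[y] = u z + s * (y - z) by rewrite /l !hornerE; ring.
have sl : (size l <= k.+1)%N.
  rewrite (leq_trans (size_polyD _ _))// geq_max (leq_trans (size_polyC_leq1 _))//=.
  by rewrite (leq_trans (size_scale_leq _ _))// size_polyX ltnS.
pose F i := u (gauss_node xi a b i) - l.[gauss_node xi a b i].
have FM i : `|F i| <= M.
  by rewrite /F lE hM//; have /andP[/ltW -> /ltW ->] := gauss_node_itv hxi i ab.
have vE : v = l + cell_interp xi a b F.
  rewrite -{1}(cell_interpK hxi ab sl) -cell_interpD; congr (cell_interp _ _ _ _).
  by apply/funext => i; rewrite addrC subrK.
have l1 : l^`() = s%:P by rewrite /l derivD derivC add0r derivZ derivX alg_polyC.
have [h1 h2 h3] := cell_interp_bound ab hx FM.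
clearbody l; rewrite vE !derivD l1 derivC add0r !hornerD hornerC lE; split => //.
- by rewrite addrAC subrr add0r.
- by rewrite addrAC subrr add0r.
Qed.

End Interpolation.

(** * Consistency of the interpolated solution on the mesh *)

Section MeshInterpolation.
Variables (R : realType) (k : nat) (xi : 'I_k.+1 -> R) (m : mesh R).
Hypotheses (hxi : gauss_legendre xi) (k1 : (1 <= k)%N).
Local Notation N := (ncells m).
Local Notation BP := (broken_poly m).
Local Notation lft j := (node m (nat_of_ord j)).
Local Notation rgt j := (node m (nat_of_ord j).+1).
Local Notation h := (mesh_size m).
Implicit Types (j : 'I_N) (i : 'I_k.+1).

Definition dg_interp (u : R -> R) : BP :=
  grid_interp xi (fun (j : 'I_N) i => u (gauss_point xi j i)).

Lemma dg_interp_Vh u : in_Vh k (dg_interp u).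
Proof. exact: grid_interp_Vh. Qed.

Lemma dg_interp_error (u : R -> R) (K : R) j x : 0 <= K -> lip K u -> lft j <= x <= rgt j ->
  `|(dg_interp u j).[x] - u x| <= (interp_const xi + 1) * (K * h).
Proof.
move=> K0 uK hx; have jh := cell_size_le j; have lr := cell_lt j.
have near y : lft j <= y <= rgt j -> `|u y - u (lft j)| <= K * h.
  move=> hy; rewrite (le_trans (uK _ _))// ler_wpM2l// ger0_norm; last lra.
  by move: jh; rewrite /cell_size; lra.
have [|h1 _ _] := @interp_near_linear _ _ _ hxi k1 u (lft j) (rgt j) (lft j) 0 (K * h) x lr hx.
  by move=> y hy; rewrite mul0r addr0 near.
have h2 := near x hx.
rewrite mul0r addr0 in h1; rewrite /dg_interp ffunE.
have -> : forall w : R, w - u x = (w - u (lft j)) - (u x - u (lft j)) by move=> w; ring.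
by rewrite (le_trans (ler_normB _ _))// mulrDl mul1r mulrC lerD.
Qed.

(* The upwind neighbour of the first cell is the last one translated by -1. *)
Lemma pred_cell (u : R -> R) j : periodic u 1 ->
  exists2 a, lft j - a = cell_size (ord_pred j) &
  let v := cell_interp xi a (lft j) (fun i => u (gauss_node xi a (lft j) i)) in
  trace_left_minus (dg_interp u) j = v.[lft j] /\
  trace_left_minus (dg_deriv (dg_interp u)) j = v^`().[lft j].
Proof.
move=> u1; rewrite /trace_left_minus /trace_right /dg_interp !ffunE.
set jp := ord_pred j; case: (posnP j) => [j0|jpos].
  have rE : rgt jp = 1.
    rewrite -(node_last m); congr (node m _).
    by rewrite /jp /= j0 add0n modn_small prednK// ncells_gt0.
  have lE : lft j = 0 by rewrite j0 node_first.
  exists (lft jp - 1); first by rewrite /cell_size rE lE; ring.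
  have [] := cell_interp_shift xi (lft jp - 1) 0 1 (fun i => u (gauss_point xi jp i)) 0.
  rewrite subrK add0r => e1 e2.
  have fE : (fun i => u (gauss_node xi (lft jp - 1) 0 i))
      = (fun i => u (gauss_point xi jp i)).
    apply/funext => i; rewrite -[LHS]u1 -gauss_node_shift subrK add0r.
    by rewrite gauss_pointE rE.
  by rewrite rE lE fE e1 e2.
have jpE : (jp : nat).+1 = j.
  rewrite /jp /=; case: (nat_of_ord j) (ltn_ord j) jpos => // j' j'N _.
  by rewrite addSn/= modnDr modn_small// ltnW.
have fE : (fun i => u (gauss_point xi jp i))
    = (fun i => u (gauss_node xi (lft jp) (lft j) i)).
  by apply/funext => i; rewrite gauss_pointE jpE.
by exists (lft jp); rewrite /cell_size ?fE jpE.
Qed.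

Section Consistency.
Variables (u : R -> R) (kappa : R) (tau : 'I_N -> R) (d : R).
Hypotheses (u1 : periodic u 1) (kh : forall j, h <= kappa * cell_size j).
Hypotheses (tau0 : forall j, 0 <= tau j) (d0 : 0 <= d) (dh : d <= h).
Hypothesis osc : forall j, exists s : R, forall y z : R,
  lft j - 2 * h <= y <= lft j + 2 * h -> lft j - 2 * h <= z <= lft j + 2 * h ->
  `|u y - u z - s * (y - z)| <= tau j * `|y - z|.

Let L := interp_const xi.
(** One constant for four estimates: [2 * L] for jumps, [4 * kappa * L] for jumps of the slope,
    [4 * kappa ^+ 2 * L] for second derivatives, [1 + 2 * kappa * L] for the transport by [d]. *)
Definition consistency_const : R := 1 + 2 * L + 4 * kappa * L + 4 * kappa ^+ 2 * L.

Lemma consistency_const_ge0 : 0 <= kappa -> 0 <= consistency_const.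
Proof.
move=> kap0; have L0 : 0 <= L by exact: interp_const_ge0.
by rewrite /consistency_const !addr_ge0// !mulr_ge0// sqr_ge0.
Qed.

(** The slope [s] of the patch around [lft j] is common to cell [j] and its upwind neighbour, so
    both traces at the interface are compared with the same linear function. At the Gauss points the
    interpolant equals [u], which leaves [u x - u (x - d)] to be compared with [d] times the
    slope. *)
Lemma dg_interp_consistency :
  [/\ 0 <= consistency_const,
      forall j, `|jump (dg_interp u) j| <= consistency_const * h * tau j,
      forall j, `|jump (dg_deriv (dg_interp u)) j| <= consistency_const * tau j,
      forall j i, `|(dg_deriv (dg_deriv (dg_interp u)) j).[gauss_point xi j i]|
        <= consistency_const / h * tau j &
      forall j i, `|(dg_interp u j).[gauss_point xi j i]
          - d * (dg_interp u j)^`().[gauss_point xi j i] - u (gauss_point xi j i - d)|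
        <= consistency_const * h * tau j].
Proof.
have h0 := mesh_size_gt0 m; have L0 : 0 <= L by exact: interp_const_ge0.
have d0' : 0 <= d by exact: d0.
have dh' : d <= h by exact: dh.
have kap0 : 0 <= kappa.
  have j := Ordinal (ncells_gt0 m); have := kh j; have := cell_size_gt0 j; nra.
have two j : 0 <= 2 / cell_size j <= 2 * kappa / h.
  have c0 := cell_size_gt0 j; apply/andP; split; first by rewrite divr_ge0// ltW.
  by rewrite ler_pdivrMr// mulrAC ler_pdivlMr// -mulrA ler_pM2l.
have kL : 0 <= kappa * L by rewrite mulr_ge0.
have kkL : 0 <= kappa ^+ 2 * L by rewrite mulr_ge0 ?sqr_ge0.
have A0 := consistency_const_ge0 kap0.
have lin j : exists s : R, (forall y : R, lft j <= y <= lft j + h ->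
      `|u y - u (y - d) - s * d| <= tau j * d) /\
    forall a b x : R, a < b -> lft j - h <= a -> b <= lft j + h -> a <= x <= b ->
    2 / (b - a) <= 2 * kappa / h ->
    let v := cell_interp xi a b (fun i => u (gauss_node xi a b i)) in
    [/\ `|v.[x] - (u (lft j) + s * (x - lft j))| <= h * tau j * L,
        `|v^`().[x] - s| <= 2 * kappa * L * tau j &
        `|v^`()^`().[x]| <= 4 * kappa ^+ 2 * L / h * tau j].
  have [s hs] := osc j; exists s; split.
    move=> y /andP[y1 y2].
    have hy : lft j - 2 * h <= y <= lft j + 2 * h by apply/andP; split; lra.
    have hyd : lft j - 2 * h <= y - d <= lft j + 2 * h by apply/andP; split; lra.
    have := hs y (y - d) hy hyd; have -> : y - (y - d) = d by ring.
    by rewrite (ger0_norm d0).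
  move=> a b x ab ha hb hx ab2 v.
  have M0 : 0 <= h * tau j by rewrite mulr_ge0// ltW.
  have [|g1 g2 g3] := @interp_near_linear _ _ _ hxi k1 u a b (lft j) s (h * tau j) x ab hx.
    move=> y hy; rewrite opprD addrA; apply: le_trans (hs _ _ _ _) _; [lra|lra|].
    by rewrite mulrC ler_wpM2r// ler_norml; lra.
  have hab : 0 <= 2 / (b - a) by rewrite divr_ge0// subr_ge0 ltW.
  split => //.
  - apply: le_trans g2 _; rewrite -/L.
    apply: le_trans (ler_wpM2r _ ab2) _; first by rewrite mulr_ge0.
    by rewrite le_eqVlt; apply/orP; left; apply/eqP; field; rewrite gt_eqF.
  - apply: le_trans g3 _; rewrite -/L.
    have ab22 : (2 / (b - a)) ^+ 2 <= (2 * kappa / h) ^+ 2.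
      by rewrite lerXn2r ?nnegrE// (le_trans hab).
    apply: le_trans (ler_wpM2r _ ab22) _; first by rewrite mulr_ge0.
    by rewrite le_eqVlt; apply/orP; left; apply/eqP; field; rewrite gt_eqF.
have both j : exists s, [/\
    `|trace_left_plus (dg_interp u) j - u (lft j)| <= h * tau j * L /\
    `|trace_left_minus (dg_interp u) j - u (lft j)| <= h * tau j * L,
    `|trace_left_plus (dg_deriv (dg_interp u)) j - s| <= 2 * kappa * L * tau j /\
    `|trace_left_minus (dg_deriv (dg_interp u)) j - s| <= 2 * kappa * L * tau j &
    forall i, let x := gauss_point xi j i in
    [/\ `|(dg_interp u j)^`().[x] - s| <= 2 * kappa * L * tau j,
        `|(dg_interp u j)^`()^`().[x]| <= 4 * kappa ^+ 2 * L / h * tau j &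
        `|u x - u (x - d) - s * d| <= tau j * d]].
  have [s [hsd hs]] := lin j; exists s.
  have jh := cell_size_le j; have lr := cell_lt j.
  have [a aE [-> ->]] := pred_cell j u1.
  have ph := cell_size_le (ord_pred j); have p0 := cell_size_gt0 (ord_pred j).
  have cj x : lft j <= x <= rgt j -> _ := fun hx =>
    hs (lft j) (rgt j) x lr ltac:(lra) ltac:(move: jh; rewrite /cell_size; lra) hx
      (proj2 (andP (two j))).
  have cp := hs a (lft j) (lft j) ltac:(lra) ltac:(lra) ltac:(lra) ltac:(lra).
  rewrite aE in cp; have {cp} /= [p1 p2 _] := cp (proj2 (andP (two (ord_pred j)))).
  have [q1 q2 _] := cj (lft j) ltac:(lra).
  rewrite /trace_left_plus /dg_interp !ffunE.
  rewrite subrr mulr0 addr0 in p1 q1.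
  split => // i; have gi := gauss_node_itv hxi i lr; rewrite -gauss_pointE in gi.
  have [_ r2 r3] := cj (gauss_point xi j i) ltac:(lra).
  split => //; apply: hsd; move: jh; rewrite /cell_size; lra.
split => //.
- move=> j; have [s [[b1 b2] _ _]] := both j.
  have : 0 <= h * tau j by rewrite mulr_ge0// ltW.
  rewrite /jump /consistency_const; move: b1 b2; rewrite !ler_norml; nra.
- move=> j; have [s [_ [b1 b2] _]] := both j; have tj := tau0 j.
  rewrite /jump /consistency_const; move: b1 b2; rewrite !ler_norml; nra.
- move=> j i; have [s [_ _ /(_ i)[_ b2 _]]] := both j.
  rewrite [dg_deriv _ _]ffunE [dg_deriv _ _]ffunE.
  apply: le_trans b2 _; rewrite ler_wpM2r// ler_wpM2r ?invr_ge0 ?(ltW h0)//.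
  by rewrite /consistency_const; lra.
- move=> j i; have [s [_ _ /(_ i)[b1 _ b3]]] := both j.
  rewrite {1}/dg_interp grid_interp_point// /consistency_const.
  have tj := tau0 j; set x := gauss_point xi j i in b1 b3 *.
  have : `|d * ((dg_interp u j)^`().[x] - s)| <= h * (2 * kappa * L * tau j).
    by rewrite normrM (ger0_norm d0) ler_pM.
  have : tau j * d <= tau j * h by rewrite ler_wpM2l.
  have : 0 <= h * tau j by rewrite mulr_ge0// ltW.
  move: b3; rewrite !ler_norml; nra.
Qed.

End Consistency.

(** The stages are characterised weakly; definiteness of [dg_dot] turns each of them into an
    identity in [V_h]. *)
Lemma rk_step_rk3 c dt (v w : BP) : in_Vh k v -> rk_step k c dt v w ->
  w = rk3 xi (c * dt) v.
Proof.
move=> hv [v1 [v2 [h1 h2 hw H]]]; pose L (y : BP) : BP := dg_op xi (c * dt) y.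
have uniq (y z : BP) : in_Vh k y -> in_Vh k z ->
    (forall phi, in_Vh k phi -> dg_dot y phi = dg_dot z phi) -> y = z.
  move=> hy hz e; apply/eqP; rewrite -subr_eq0; apply/eqP/dg_dot_eq0.
  by rewrite dg_dotDl dg_dotNl e ?subrr//; exact: in_VhB.
have hL y : in_Vh k y -> in_Vh k (L y) by exact: dg_op_Vh.
have e1 : v1 = v + L v.
  apply: uniq => // [|phi hp]; first by apply: in_VhD => //; exact: hL.
  have [+ _ _] := H phi hp; rewrite (L2_dot_eq_dg (v := v1 - v)).
    by rewrite dgHE dg_dotE dg_dotDl dg_opE// dg_dotNl => /(canRL (subrK _)); rewrite addrC.
  by move=> j x xj; rewrite !(dg_funE _ xj) broken_polyD broken_polyN hornerD hornerN.
have e2 : v2 = (3 / 4) *: v + (1 / 4) *: v1 + (1 / 4) *: L v1.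
  apply: uniq => // [|phi hp].
    by do ![apply: in_VhD|apply: in_VhZ|apply: hL].
  have [_ + _] := H phi hp.
  rewrite (L2_dot_eq_dg (v := v2 - (3 / 4) *: v - (1 / 4) *: v1)).
    rewrite dgHE !dg_dotE dg_opE//; lra.
  move=> j x xj; rewrite !(dg_funE _ xj) !(broken_polyD, broken_polyN, broken_polyZ).
  by rewrite !(hornerD, hornerN, hornerZ).
have e3 : w = (1 / 3) *: v + (2 / 3) *: v2 + (2 / 3) *: L v2.
  apply: uniq => // [|phi hp].
    by do ![apply: in_VhD|apply: in_VhZ|apply: hL].
  have [_ _] := H phi hp.
  rewrite (L2_dot_eq_dg (v := w - (1 / 3) *: v - (2 / 3) *: v2)).
    rewrite dgHE !dg_dotE dg_opE//; lra.
  move=> j x xj; rewrite !(dg_funE _ xj) !(broken_polyD, broken_polyN, broken_polyZ).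
  by rewrite !(hornerD, hornerN, hornerZ).
have LD y z : L (y + z) = L y + L z by exact: dg_opD.
have LZ a y : L (a *: y) = a *: L y by exact: dg_opZ.
rewrite /rk3 -/(L v) -/(L (L v)) -/(L (L (L v))).
clearbody L; rewrite e3 e2 e1 !(LD, LZ).
move: (L v) (L (L v)) (L (L (L v))) => y1 y2 y3.
apply/ffunP => j; rewrite !(broken_polyD, broken_polyZ); apply/polyP => i.
by rewrite !(coefD, coefZ); field.
Qed.

End MeshInterpolation.
(** * The error estimate *)

Section ErrorEstimate.
Variables (R : realType) (k : nat) (xi : 'I_k.+1 -> R) (m : mesh R).
Variables (c dt Cinv K V T : R) (m0 : nat) (u0 g : R -> R) (rule : obstacle_rule).
Hypotheses (hxi : gauss_legendre xi) (k1 : (1 <= k)%N) (hc : 0 < c) (dt0 : 0 < dt).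
Hypotheses (K0 : 0 <= K) (u0K : lip K u0) (gK : lip K g).
Hypotheses (u0p : periodic u0 1) (gp : periodic g 1).
Hypothesis hinv : inverse_inequalities m k Cinv.
Local Notation N := (ncells m).
Local Notation BP := (broken_poly m).
Local Notation lft j := (node m (nat_of_ord j)).
Local Notation h := (mesh_size m).
Local Notation d := (c * dt).
Local Notation u := (exact_solution c u0 g).
Hypothesis cfl : d * (Cinv / h + 2 * (Cinv ^+ 2 / h)) <= 1.
Hypothesis dh : d <= h.
Hypothesis m0P : 4 * Cinv ^+ 2 <= m0%:R.
Hypothesis V0 : 0 <= V.
Hypothesis hV : forall t : R, 0 <= t <= T -> bv_slope (u t) (-2) 3 V.
Implicit Types (j : 'I_N) (i : 'I_k.+1) (t : R).

(** The radius [2 * h] accommodates the cell, its upwind neighbour, and the points [x - 2 * d] and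
    [x + d] needed for the endpoint rule. By [quasi_uniform] successive nodes are at least
    [h / Cinv ^+ 2] apart, and [m0] such lengths cover a patch of width [4 * h]. *)
Lemma local_oscillation t : 0 <= t <= T -> exists tau : 'I_N -> R,
  [/\ forall j, 0 <= tau j, \sum_j tau j ^+ 2 <= (m0%:R * V) ^+ 2 &
    forall j, exists s : R, forall y z : R,
      lft j - 2 * h <= y <= lft j + 2 * h -> lft j - 2 * h <= z <= lft j + 2 * h ->
      `|u t y - u t z - s * (y - z)| <= tau j * `|y - z|].
Proof.
move=> /hV[Phi [mono tot osc]]; have h0 := mesh_size_gt0 m; have h1 := mesh_size_le1 m.
have C0 := inverse_constant_gt0 hinv; have C20 : 0 < Cinv ^+ 2 by rewrite exprn_gt0.
pose tau j := Phi (lft j + 2 * h) - Phi (lft j - 2 * h).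
have tau0 j : 0 <= tau j by rewrite subr_ge0 mono//; lra.
exists tau; split => // [|j]; last first.
  have /andP[l0 l1] := node_itv (ltnW (ltn_ord j)).
  by apply: osc; lra.
apply: le_trans (sum_sqr_le tau0) _.
rewrite lerXn2r ?nnegrE ?mulr_ge0 ?sumr_ge0//.
have inc (n : nat) : (n < N)%N -> node m n + h / Cinv ^+ 2 <= node m n.+1.
  move=> nN; have := quasi_uniform hinv (Ordinal nN); rewrite /cell_size/=.
  by rewrite -ler_pdivrMl// mulrC; lra.
have S := increment_sum m0 (- (2 * h)) mono tot inc.
apply: (le_trans _ S).
apply: ler_sum => j _; rewrite /tau lerD2r mono//.
have : 4 * h <= m0%:R * (h / Cinv ^+ 2).
  by rewrite mulrA ler_pdivlMr// mulrAC ler_wpM2r// ltW.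
lra.
Qed.

Lemma d_gt0 : 0 < d. Proof. exact: mulr_gt0. Qed.

Let inv_d := inverse_deriv hinv.
Let inv_t := fun phi j x (hp : in_Vh k phi) => @inverse_trace _ _ _ _ hinv phi j x hp.
Let L := interp_const xi.
Let sg := m0%:R * V.
Let A := consistency_const xi (Cinv ^+ 2).
Let Iu (n : nat) : BP := dg_interp xi m (u (n%:R * dt)).

Lemma Ct_ge0 : 0 <= Cinv ^+ 2 / h.
Proof. by rewrite divr_ge0 ?sqr_ge0// ltW// mesh_size_gt0. Qed.

Lemma sg_ge0 : 0 <= sg. Proof. exact: mulr_ge0. Qed.

Lemma exact_step (n : nat) x :
  u (n.+1%:R * dt) x = Num.max (u (n%:R * dt) (x - d)) (obstacle_max c g dt x).
Proof.
rewrite -natr1 mulrDl mul1r (exact_solutionD hc K0 gK)//.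
by rewrite mulr_ge0// ltW.
Qed.

Lemma uK t : 0 <= t -> lip K (u t).
Proof. by move=> t0; have := exact_solution_lip hc K0 gK u0K t0; rewrite maxxx. Qed.

Lemma truncation_error (n : nat) : n%:R * dt <= T ->
  dg_norm (rk3 xi d (Iu n)
    - grid_interp xi (fun j i => u (n%:R * dt) (gauss_point xi j i - d)))
  <= A * (2 + 3 * Cinv) * sg * (h * Num.sqrt h).
Proof.
move=> nT; have t0 : 0 <= n%:R * dt by rewrite mulr_ge0// ltW.
have [|tau [tau0 tau_sg osc]] := @local_oscillation (n%:R * dt); first by rewrite t0.
have per : periodic (u (n%:R * dt)) 1.
  by move=> x; exact: exact_solution_periodic.
have C0 := inverse_constant_gt0 hinv; have h0 := mesh_size_gt0 m.
have [A0 c1 c2 c3 c4] := dg_interp_consistency hxi k1 per (quasi_uniform hinv)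
  tau0 (ltW d_gt0) dh osc.
exact: (rk3_truncation hxi Ct_ge0 (ltW d_gt0) inv_d inv_t cfl h0 (@cell_size_le _ m)
  dh sg_ge0 tau_sg (dg_interp_Vh _ _) A0 (ltW C0) erefl c1 c2 c3 c4).
Qed.

(** For [n = 0] the datum [u0] may lie below [g], and the Lipschitz bound is used. Later on,
    [endpoint_consistency] involves two consecutive times, so [ta + tb] plays the role of [tau];
    hence [2 * sg], and the constant 6 as 3 times 2. *)
Lemma obstacle_error (n : nat) : n.+1%:R * dt <= T ->
  dg_norm (grid_interp xi (fun j i => u (n.+1%:R * dt) (gauss_point xi j i)
     - Num.max (u (n%:R * dt) (gauss_point xi j i - d))
         (gtilde rule c g dt (gauss_point xi j i))))
  <= (if n == 0%N then K * d else 6 * d * sg * Num.sqrt h).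
Proof.
move=> nT; have h0 := mesh_size_gt0 m; have d0 := d_gt0.
have gb x := gtilde_bounds hc K0 gK rule x dt0.
have e0 j i : 0 <= u (n.+1%:R * dt) (gauss_point xi j i)
    - Num.max (u (n%:R * dt) (gauss_point xi j i - d))
        (gtilde rule c g dt (gauss_point xi j i)).
  have [g1 _ _] := gb (gauss_point xi j i).
  by rewrite subr_ge0 exact_step ge_max !le_max lexx g1 orbT.
case: n nT e0 => [|n] nT e0; rewrite [leRHS]/=.
  have Kd0 : 0 <= K * d by rewrite mulr_ge0// ltW.
  rewrite -(ger0_norm Kd0) -sqrtr_sqr ler_wsqrtr//.
  apply: le_trans (dg_dot_gauss_bound hxi (B := fun=> K * d) _ _) _.
  - exact: grid_interp_Vh.
  - move=> j i; rewrite grid_interp_point// ger0_norm//.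
    have [_ g2 _] := gb (gauss_point xi j i); rewrite exact_step lerBlDr ge_max.
    apply/andP; split.
      by rewrite (ler_wpDl Kd0)// le_max lexx.
    apply: le_trans (_ : _ <= K * d + gtilde rule c g dt (gauss_point xi j i)) _; first lra.
    by rewrite lerD2l le_max lexx orbT.
  - by rewrite -mulr_suml sum_cell_size mul1r.
have t0 : 0 < n.+1%:R * dt by rewrite mulr_gt0.
have nn : n.+2%:R * dt = n.+1%:R * dt + dt by rewrite -natr1 mulrDl mul1r.
have [|ta [ta0 ta_sg osca]] := @local_oscillation (n.+1%:R * dt).
  by rewrite (ltW t0)/= (le_trans _ nT)// nn lerDl ltW.
have [|tb [tb0 tb_sg oscb]] := @local_oscillation (n.+2%:R * dt).
  by rewrite nT andbT nn addr_ge0// ltW.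
have sg2 : \sum_j (ta j + tb j) ^+ 2 <= (2 * sg) ^+ 2.
  apply: (@le_trans _ _ (2 * (\sum_j ta j ^+ 2 + \sum_j tb j ^+ 2))).
    rewrite -big_split mulr_sumr; apply: ler_sum => j _ /=.
    by have := sqr_ge0 (ta j - tb j); nra.
  rewrite /sg; lra.
have -> : 6 * d * sg * Num.sqrt h = (3 * d) * (2 * sg) * Num.sqrt h by ring.
apply: (gauss_norm_le hxi (tau := fun j => ta j + tb j)) => //.
- exact: cell_size_le.
- by rewrite mulr_ge0// sg_ge0.
- exact: grid_interp_Vh.
- by rewrite mulr_ge0// ltW.
move=> j i; rewrite grid_interp_point// ger0_norm//.
have tab : 0 <= ta j + tb j by rewrite addr_ge0.
set x := gauss_point xi j i.
case: rule => /=.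
  by rewrite exact_step subrr !mulr_ge0// ltW.
have [sa ha] := osca j; have [sb hb] := oscb j.
have xj := gauss_node_itv hxi i (cell_lt j); rewrite -gauss_pointE -/x in xj.
have jh := cell_size_le j; rewrite /cell_size in jh.
have dh' : d <= h by exact: dh.
rewrite nn; apply: (endpoint_consistency hc K0 gK (al := lft j - 2 * h)
  (be := lft j + 2 * h) (su := sa) (sU := sb)) => //; [lra|lra| |].
- move=> y z hy hz; apply: le_trans (ha y z hy hz) _.
  by rewrite ler_wpM2r// lerDl.
- move=> y z hy hz; rewrite -nn; apply: le_trans (hb y z hy hz) _.
  by rewrite ler_wpM2r// lerDr.
Qed.

Variable uh : nat -> BP.
Hypothesis scheme : rkdg_obstacle_scheme xi c dt u0 (gtilde rule c g dt) uh.

Lemma uh_Vh (n : nat) : in_Vh k (uh n).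
Proof. by case: n => [|n]; [have [[]] := scheme|have [_ /(_ n)[]] := scheme]. Qed.

Lemma error_step (n : nat) : n.+1%:R * dt <= T ->
  dg_norm (uh n.+1 - Iu n.+1) <= dg_norm (uh n - Iu n)
    + A * (2 + 3 * Cinv) * sg * (h * Num.sqrt h)
    + (if n == 0%N then K * d else 6 * d * sg * Num.sqrt h).
Proof.
move=> nT; have nT' : n%:R * dt <= T.
  by move: nT; rewrite -natr1 mulrDl mul1r; have := dt0; lra.
have [_ /(_ n)[_ [w rkw max_w]]] := scheme.
have wE := rk_step_rk3 hxi (uh_Vh n) rkw.
set ut := grid_interp xi (fun j i => u (n%:R * dt) (gauss_point xi j i - d)).
have h0 := mesh_size_gt0 m; have C0 := inverse_constant_gt0 hinv.
have hIu : in_Vh k (Iu n) by exact: dg_interp_Vh.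
have huh := uh_Vh n.
have wut : dg_norm (w - ut) <= dg_norm (uh n - Iu n)
    + A * (2 + 3 * Cinv) * sg * (h * Num.sqrt h).
  have -> : w - ut = rk3 xi d (uh n - Iu n) + (rk3 xi d (Iu n) - ut).
    by rewrite rk3D rk3N -wE addrA subrK.
  apply: le_trans (dg_normD _ _) _; apply: lerD; last exact: truncation_error.
  exact: (rk3_stable hxi Ct_ge0 (ltW d_gt0) inv_d inv_t cfl (in_VhB huh hIu)).
have hw : in_Vh k w by rewrite wE; exact: rk3_Vh.
apply: (le_trans _ (lerD wut (obstacle_error nT))).
apply: (dg_norm_gauss_leD hxi).
- by apply: in_VhB; [exact: uh_Vh|exact: dg_interp_Vh].
- by apply: in_VhB => //; exact: grid_interp_Vh.
- exact: grid_interp_Vh.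
move=> j i; rewrite !broken_polyD !broken_polyN !hornerD !hornerN max_w.
rewrite !grid_interp_point//; set x := gauss_point xi j i.
set a := (w j).[x]; set b := u _ (x - d); set gt := gtilde _ _ _ _ _; set U := u _ x.
have -> : Num.max a gt - U = (Num.max a gt - Num.max b gt) - (U - Num.max b gt) by ring.
apply: le_trans (ler_normB _ _) _; rewrite lerD2r.
exact: max_nonexpansive.
Qed.

Lemma initial_error : dg_norm (uh 0%N - Iu 0%N) <= (L + 1) * (K * h).
Proof.
have [proj _] := scheme; have h0 := mesh_size_gt0 m.
have L0 : 0 <= L by exact: interp_const_ge0.
have uE : u (0 * dt) = u0 by apply/funext => x; rewrite /exact_solution mul0r eqxx.
apply: (L2_projection_error (u := u0)) proj _ => //.
- exact: lip_continuous u0K.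
- by rewrite !mulr_ge0 ?addr_ge0// ltW.
- exact: dg_interp_Vh.
- move=> j x hx; rewrite /Iu uE; apply: dg_interp_error => //; lra.
Qed.

(** The obstacle error of the first step is paid once, by the summand [K * d]; every step, the first
    included, is charged the amount of a later step. *)
Lemma error_iter (n : nat) : n%:R * dt <= T ->
  dg_norm (uh n - Iu n) <= (L + 1) * (K * h) + K * d
    + n%:R * (A * (2 + 3 * Cinv) * sg * (h * Num.sqrt h) + 6 * d * sg * Num.sqrt h).
Proof.
have d0 := d_gt0; have Kd : 0 <= K * d by rewrite mulr_ge0// ltW.
have h0 := mesh_size_gt0 m; have s0 := sg_ge0.
have B0 : 0 <= 6 * d * sg * Num.sqrt h by rewrite !mulr_ge0 ?sqrtr_ge0// ltW.
elim: n => [_|n IH nT]; first by rewrite mul0r addr0; have := initial_error; lra.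
have nT' : n%:R * dt <= T by move: nT; rewrite -natr1 mulrDl mul1r; have := dt0; lra.
have st := error_step nT; move: (IH nT') st; case: n {IH nT nT'} => [|n] /= IH st.
  have := initial_error; move: st; rewrite mul1r.
  set X := dg_norm _; set Y := dg_norm _; lra.
move: IH st; rewrite -[n.+2%:R]natr1 [(n.+1%:R + 1) * _]mulrDl mul1r.
set X := dg_norm _; set Y := dg_norm _; lra.
Qed.

Lemma L2_error (n : nat) : n%:R * dt <= T ->
  L2_norm (fun x => dg_fun (uh n) x - u (n%:R * dt) x)
  <= 2 * (2 * (L + 1) * K + K + T * (A * (2 + 3 * Cinv) * sg) + 6 * sg * c * T)
     * Num.sqrt (h + h ^+ 3 / dt ^+ 2).
Proof.
move=> nT; have t0 : 0 <= n%:R * dt by rewrite mulr_ge0// ltW.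
have h0 := mesh_size_gt0 m; have h1 := mesh_size_le1 m.
have L0 : 0 <= L by exact: interp_const_ge0.
have C0 := inverse_constant_gt0 hinv; have s0 := sg_ge0.
have A0 : 0 <= A by apply: consistency_const_ge0; exact: sqr_ge0.
have T0 : 0 <= T by exact: le_trans nT.
set S := Num.sqrt _; set q := Num.sqrt h.
have q0 : 0 <= q by exact: sqrtr_ge0.
have hq : h = q ^+ 2 by rewrite sqr_sqrtr// ltW.
have q1 : q <= 1 by rewrite -sqrtr1 ler_wsqrtr.
have hdt : 0 <= h ^+ 3 / dt ^+ 2 by rewrite divr_ge0 ?exprn_ge0// ltW.
have qS : q <= S by rewrite ler_wsqrtr// lerDl.
(* The square of [h * q / dt] is [h ^+ 3 / dt ^+ 2]: this is the truncation error [h * q]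
   accumulated over at most [T / dt] steps. *)
have hqS : h * q / dt <= S.
  have hq0 : 0 <= h * q / dt by rewrite !mulr_ge0// ?invr_ge0 ltW.
  rewrite -(ger0_norm hq0) -sqrtr_sqr ler_wsqrtr// !exprMn exprVn -hq.
  by rewrite -exprSr lerDr ltW.
have hS : h <= S by apply: le_trans qS; rewrite hq; nra.
have dS : d <= S by exact: le_trans hS.
have n1 : n%:R * (h * q) <= T * S.
  have -> : n%:R * (h * q) = (n%:R * dt) * (h * q / dt) by field; rewrite gt_eqF.
  by rewrite ler_pM// ?divr_ge0 ?mulr_ge0// ltW.
have n2 : n%:R * d * q <= c * T * S.
  have -> : n%:R * d * q = c * (n%:R * dt) * q by ring.
  by rewrite ler_pM// ?mulr_ge0 ?ler_wpM2l// ltW.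
apply: le_trans (dg_norm_L2_error (v := Iu n) (B := (L + 1) * (K * h)) (uh n) _ _ _) _.
- exact: lip_continuous (uK t0).
- by rewrite !mulr_ge0 ?addr_ge0// ltW.
- by move=> j x hx; apply: dg_interp_error => //; [exact: uK|lra].
rewrite -mulrA ler_pM2l//.
have P1 : (L + 1) * (K * h) <= (L + 1) * K * S.
  by rewrite -mulrA ler_wpM2l ?addr_ge0// ler_wpM2l.
have P2 : K * d <= K * S by rewrite ler_wpM2l.
have P3 : A * (2 + 3 * Cinv) * sg * (n%:R * (h * q)) <= A * (2 + 3 * Cinv) * sg * (T * S).
  by rewrite ler_wpM2l// !mulr_ge0// addr_ge0// mulr_ge0// ltW.
have P4 : 6 * sg * (n%:R * d * q) <= 6 * sg * (c * T * S).
  by rewrite ler_wpM2l// mulr_ge0.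
have := error_iter nT; rewrite -/q; set E := dg_norm _.
move: P1 P2 P3 P4.
set X1 := (L + 1) * _; lra.
Qed.

End ErrorEstimate.
Theorem theorem5p3 (R : realType) (c : R) (k : nat) (xi : 'I_k.+1 -> R)
    (Cinv : R) (hc : 0 < c) (hk : (1 <= k)%N) (hxi : gauss_legendre xi) :
  exists2 C0 : R, 0 < C0 &
  forall (T : R) (u0 g : R -> R) (l : nat),
    0 < T ->
    periodic u0 1 -> periodic g 1 -> lipschitz u0 -> lipschitz g ->
    (2 <= l)%N ->
    not_shattering l T (exact_solution c u0 g) ->
  forall rule : obstacle_rule,
    (exists2 C : R, 0 <= C &
       forall (m : mesh R) (dt : R) (uh : nat -> broken_poly m),
         inverse_inequalities m k Cinv ->
         0 < dt -> dt <= C0 * mesh_size m ->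
         rkdg_obstacle_scheme xi c dt u0 (gtilde rule c g dt) uh ->
       forall n : nat, n%:R * dt <= T ->
         L2_norm (fun x => dg_fun (uh n) x
                           - exact_solution c u0 g (n%:R * dt) x)
         <= C * Num.sqrt (mesh_size m + mesh_size m ^+ 3 / dt ^+ 2))
    /\
    (forall Cbar0 : R, 0 < Cbar0 ->
     exists C1 : R,
       forall (m : mesh R) (dt : R) (uh : nat -> broken_poly m),
         inverse_inequalities m k Cinv ->
         0 < dt -> dt <= C0 * mesh_size m ->
         Cbar0 <= dt / mesh_size m ->
         rkdg_obstacle_scheme xi c dt u0 (gtilde rule c g dt) uh ->
       forall n : nat, n%:R * dt <= T ->
         L2_norm (fun x => dg_fun (uh n) x
                           - exact_solution c u0 g (n%:R * dt) x)
         <= C1 * Num.sqrt (mesh_size m)).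
Proof.
(* The summand 1 of [M] yields [c * dt <= h], the others the contraction condition. The sign of
   [Cinv] is known only once some mesh satisfies the inverse inequalities; hence the absolute
   value. *)
pose M := 1 + `|Cinv| + 2 * Cinv ^+ 2.
have M1 : 1 <= M by rewrite /M -addrA lerDl addr_ge0// mulr_ge0 ?sqr_ge0.
have M0 : 0 < M by exact: lt_le_trans M1.
exists (c * M)^-1; first by rewrite invr_gt0 mulr_gt0.
move=> T u0 g l T0 u0p gp /lipschitz_lip[K0 K00 u0K] /lipschitz_lip[Kg Kg0 gK] l2
  [p [L [c0 hreg]]] rule.
pose K := Num.max K0 Kg.
have hK : 0 <= K by rewrite le_max K00.
have u0K' : lip K u0.
  by move=> x y; rewrite (le_trans (u0K x y))// ler_wpM2r// le_max lexx.
have gK' : lip K g.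
  by move=> x y; rewrite (le_trans (gK x y))// ler_wpM2r// le_max lexx orbT.
have [V hV] := piecewise_class_bv_slope p L c0 (ltnW l2) hK.
have ubv t : 0 <= t <= T -> bv_slope (exact_solution c u0 g t) (-2) 3 `|V|.
  move=> ht; have /andP[t0 _] := ht; apply: bv_slopeW (ler_norm V) _.
  apply: hV; last exact: hreg.
    by have := exact_solution_lip hc hK gK' u0K' t0; rewrite maxxx.
  by move=> x; exact: exact_solution_periodic.
have [m0 m0P] : exists m0 : nat, 4 * Cinv ^+ 2 <= m0%:R.
  exists (Num.bound (4 * Cinv ^+ 2)); apply/ltW/archi_boundP.
  by rewrite mulr_ge0// sqr_ge0.
pose sg := m0%:R * `|V|.
pose A := consistency_const xi (Cinv ^+ 2).
(* For the same reason the sign of [C] is not yet known, and its absolute value is the constant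
   returned. *)
pose C := 2 * (2 * (interp_const xi + 1) * K + K
  + T * (A * (2 + 3 * Cinv) * sg) + 6 * sg * c * T).
have main (m : mesh R) (dt : R) (uh : nat -> broken_poly m) :
    inverse_inequalities m k Cinv -> 0 < dt ->
    dt <= (c * M)^-1 * mesh_size m ->
    rkdg_obstacle_scheme xi c dt u0 (gtilde rule c g dt) uh ->
    forall n : nat, n%:R * dt <= T ->
    L2_norm (fun x => dg_fun (uh n) x - exact_solution c u0 g (n%:R * dt) x)
    <= `|C| * Num.sqrt (mesh_size m + mesh_size m ^+ 3 / dt ^+ 2).
  move=> hinv dt0 hdt scheme n nT.
  have h0 := mesh_size_gt0 m; have C0 := inverse_constant_gt0 hinv.
  have dM : c * dt * M <= mesh_size m.
    by move: hdt; rewrite mulrC ler_pdivlMr ?mulr_gt0//; lra.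
  have d0 : 0 < c * dt by rewrite mulr_gt0.
  have hcfl : c * dt * (Cinv / mesh_size m + 2 * (Cinv ^+ 2 / mesh_size m)) <= 1.
    have -> : c * dt * (Cinv / mesh_size m + 2 * (Cinv ^+ 2 / mesh_size m))
        = c * dt * (Cinv + 2 * Cinv ^+ 2) / mesh_size m by ring.
    rewrite ler_pdivrMr// mul1r; apply: le_trans dM; rewrite ler_pM2l// /M.
    by rewrite gtr0_norm//; lra.
  have hdh : c * dt <= mesh_size m by apply: le_trans dM; rewrite ler_pMr.
  have E := L2_error hxi hk hc dt0 hK u0K' gK' u0p gp hinv hcfl hdh m0P
    (normr_ge0 V) ubv scheme nT.
  by apply: le_trans E _; rewrite ler_wpM2r ?sqrtr_ge0// ler_norm.
split; first by exists `|C|.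
move=> Cbar Cbar0; exists (`|C| * Num.sqrt (1 + Cbar ^- 2)) => m dt uh hinv dt0 hdt hbar sch n nT.
have h0 := mesh_size_gt0 m.
apply: le_trans (main m dt uh hinv dt0 hdt sch n nT) _.
rewrite -[leRHS]mulrA ler_wpM2l// -sqrtrM; last first.
  by rewrite addr_ge0// invr_ge0 exprn_ge0// ltW.
rewrite ler_wsqrtr// mulrDl mul1r lerD2l.
have hd : mesh_size m / dt <= Cbar^-1.
  by rewrite ler_pdivrMr// ler_pdivlMl//; move: hbar; rewrite ler_pdivlMr.
have -> : mesh_size m ^+ 3 / dt ^+ 2 = (mesh_size m / dt) ^+ 2 * mesh_size m.
  by rewrite exprMn exprVn; ring.
have hd0 : 0 <= mesh_size m / dt by rewrite divr_ge0// ltW.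
by rewrite ler_wpM2r ?(ltW h0)// -exprVn lerXn2r ?nnegrE ?(le_trans hd0 hd).
Qed.
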